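(* For each $N\ge1$ let $P_N$ be a polynomial chosen at random from $\Omega_N$ (respectively, from $\Omega^P_N$) according to normalized Lebesgue measure. Then, as $N\to\infty$, the roots of $P_N$ become uniformly distributed about the unit circle: if $z_1,\dots,z_N\in\mathbf{C}$ are the roots of $P_N$ with multiplicity, then for every bounded continuous function $f:\mathbf{C}\to\mathbf{R}$ and every $\epsilon>0$, the probability that $$\left|\frac1N\sum_{j=1}^N f(z_j)-\frac1{2\pi}\int_0^{2\pi}f(e^{i\theta})\,d\theta\right|>\epsilon$$ tends to $0$ as $N\to\infty$. This holds both for $\Omega_N$ and for $\Omega^P_N$.
   Context: Identify a monic real polynomial $x^N+a_1x^{N-1}+\cdots+a_N$ with the point $(a_1,\dots,a_N)\in\mathbf{R}^N$. $\Omega_N\subset\mathbf{R}^N$ is the compact region of monic real polynomials of degree $N$ all of whose complex roots have absolute value at most $1$. $\Omega^P_N\subset\Omega_N$ is the region of polynomials that have a unique root of largest absolute value (this root is then necessarily real). Both have positive finite Lebesgue measure. *)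

(* Defs.v *)
From HB Require Import structures.
From mathcomp Require Import all_boot all_order all_algebra.
From mathcomp Require Import all_classical all_reals all_analysis.
From mathcomp Require Import zify.
From mathcomp Require Export complex.

Set Implicit Arguments.
Unset Strict Implicit.
Unset Printing Implicit Defensive.

Import Order.TTheory GRing.Theory Num.Theory.
Import numFieldNormedType.Exports.

Local Open Scope classical_set_scope.
Local Open Scope ring_scope.

Section LebesgueTuple.
Context {R : realType}.
Local Notation mR := (measurableTypeR R).

Definition cons_pair (N : nat) (x : mR * N.-tuple mR) : N.+1.-tuple mR :=
  [the N.+1.-tuple mR of x.1 :: x.2].

Lemma measurable_cons_pair N : measurable_fun setT (@cons_pair N).
Proof. exact: measurable_cons. Qed.

Section Succ.
Variables (N : nat) (mu : {sigma_finite_measure set (N.-tuple mR) -> \bar R}).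

Definition lebesgue_succ : set (N.+1.-tuple mR) -> \bar R :=
  pushforward (lebesgue_measure \x mu)%E (@cons_pair N).

Let measurable_preimage A : measurable A -> measurable (@cons_pair N @^-1` A).
Proof.
by move=> mA; rewrite -[X in measurable X]setTI; exact: measurable_cons_pair.
Qed.

Let lebesgue_succ0 : lebesgue_succ set0 = 0%E.
Proof. by rewrite /lebesgue_succ /pushforward preimage_set0 measure0. Qed.

Let lebesgue_succ_ge0 A : (0 <= lebesgue_succ A)%E.
Proof. exact: (measure_ge0 (lebesgue_measure \x mu)%E). Qed.

Let lebesgue_succ_sigma_additive : semi_sigma_additive lebesgue_succ.
Proof.
move=> F mF tF mUF; rewrite /lebesgue_succ /pushforward preimage_bigcup.
apply: measure_semi_sigma_additive.
- by move=> n; exact: measurable_preimage.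
- apply/trivIsetP => /= i j _ _ ij; rewrite -preimage_setI.
  by move/trivIsetP : tF => /(_ _ _ _ _ ij) ->//; rewrite preimage_set0.
- by rewrite -preimage_bigcup; exact: measurable_preimage.
Qed.

HB.instance Definition _ := isMeasure.Build _ _ _ lebesgue_succ
  lebesgue_succ0 lebesgue_succ_ge0 lebesgue_succ_sigma_additive.

Let uncons (t : N.+1.-tuple mR) : mR * N.-tuple mR :=
  (thead t, [tuple of behead t]).

Let measurable_uncons : measurable_fun setT uncons.
Proof.
apply/measurable_fun_pairP; split; first exact: measurable_tnth.
exact: measurable_behead.
Qed.

Let cons_pairK : cancel (@cons_pair N) uncons.
Proof.
by case=> x t; congr pair; apply: val_inj.
Qed.

Let lebesgue_succ_sigma_finite : sigma_finite setT lebesgue_succ.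
Proof.
have /sigma_finiteP[F [TF ndF Foo]] :=
  sigma_finiteT (@lebesgue_measure R : {sigma_finite_measure set mR -> \bar R}).
have /sigma_finiteP[G [TG ndG Goo]] := sigma_finiteT mu.
exists (fun n => uncons @^-1` (F n `*` G n)).
  rewrite -preimage_bigcup (_ : \bigcup_n _ = setT) ?preimage_setT//.
  apply/seteqP; split=> // -[x t] _.
  have [n _ Fx] : (\bigcup_n F n) x by rewrite -TF.
  have [m _ Gt] : (\bigcup_n G n) t by rewrite -TG.
  exists (maxn n m) => //; split.
    by move: x Fx; exact/subsetPset/ndF/leq_maxl.
  by move: t Gt; exact/subsetPset/ndG/leq_maxr.
move=> n; have [mF Fn] := Foo n; have [mG Gn] := Goo n; split.
  rewrite -[X in measurable X]setTI; apply: measurable_uncons => //.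
  exact: measurableX.
rewrite /lebesgue_succ /pushforward (_ : _ @^-1` _ = F n `*` G n); last first.
  by apply/funext => x; rewrite /preimage /mkset cons_pairK.
by rewrite product_measure1E// lte_mul_pinfty// ge0_fin_numE.
Qed.

HB.instance Definition _ := Measure_isSigmaFinite.Build _ _ _ lebesgue_succ
  lebesgue_succ_sigma_finite.

End Succ.

Fixpoint lebesgue_tuple (N : nat) :
    {sigma_finite_measure set (N.-tuple mR) -> \bar R} :=
  match N with
  | 0 => \d_([tuple] : 0.-tuple mR)
  | N'.+1 => lebesgue_succ (lebesgue_tuple N')
  end.

Lemma lebesgue_tuple_box (N : nat) (A : 'I_N -> set mR) :
  (forall i, measurable (A i)) ->
  lebesgue_tuple N [set t | forall i, A i (tnth t i)] =
  (\prod_(i < N) lebesgue_measure (A i))%E.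
Proof.
elim: N A => [|N IH] A mA /=.
  rewrite big_ord0 diracE mem_set//=; by case.
rewrite big_ord_recl /lebesgue_succ /pushforward.
rewrite (_ : _ @^-1` _ = A ord0 `*`
  [set t : N.-tuple mR | forall i, A (lift ord0 i) (tnth t i)]); last first.
  apply/seteqP; split=> -[x t] /=.
    move=> H; split; first exact: (H ord0).
    by move=> i; have := H (lift ord0 i); rewrite tnthS.
  by move=> [H0 H] i; case: (unliftP ord0 i) => [j|] ->//; rewrite tnthS.
rewrite product_measure1E//; last first.
  rewrite (_ : [set _ | _] = \bigcap_(i in [set: 'I_N])
     ((@tnth _ mR ^~ i) @^-1` A (lift ord0 i))); last first.
    by apply/seteqP; split => [t H i _|t H i]; [exact: H|exact: (H i I)].
  apply: fin_bigcap_measurable; first exact: finite_finset.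
  move=> i _; rewrite -[X in measurable X]setTI.
  exact: measurable_tnth.
by congr (_ * _)%E; exact: IH.
Qed.
End LebesgueTuple.

Section RandomPolynomials.
Context {R : realType}.
Implicit Types N : nat.

(* [tnth a i], with [i] counted from 0, is the coefficient a_(i+1) of X^(N-i-1). *)
Definition poly_of_coefs N (a : N.-tuple R) : {poly R} :=
  'X^N + \sum_(i < N) tnth a i *: 'X^(N - i.+1).

Definition cpoly_of_coefs N (a : N.-tuple R) : {poly R[i]} :=
  map_poly (real_complex R) (poly_of_coefs a).

Definition croots N (a : N.-tuple R) : seq R[i] :=
  sval (closed_field_poly_normal (cpoly_of_coefs a)).

Lemma size_poly_of_coefs N (a : N.-tuple R) : size (poly_of_coefs a) = N.+1.
Proof.
rewrite /poly_of_coefs size_polyDl ?size_polyXn// ltnS.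
apply/(leq_trans (size_sum _ _ _))/bigmax_leqP => i _.
by rewrite (leq_trans (size_scale_leq _ _))// size_polyXn subnSK// leq_subr.
Qed.

Lemma monic_poly_of_coefs N (a : N.-tuple R) : poly_of_coefs a \is monic.
Proof.
have := size_poly_of_coefs a; rewrite /poly_of_coefs => sz.
rewrite monicE lead_coefE sz /= coefD coefXn eqxx coef_sum big1 ?addr0// => i _.
rewrite coefZ coefXn; case: eqP => [/esym|_]; rewrite ?mulr0// => H.
have iN := ltn_ord i; by move: (leq_subr i N.-1); lia.
Qed.

Lemma croots_prod N (a : N.-tuple R) :
  cpoly_of_coefs a = \prod_(z <- croots a) ('X - z%:P).
Proof.
rewrite /croots; case: closed_field_poly_normal => r /= {1}->.
rewrite (monicP _) ?scale1r//.
by rewrite /cpoly_of_coefs map_monic monic_poly_of_coefs.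
Qed.

Lemma size_croots N (a : N.-tuple R) : size (croots a) = N.
Proof.
apply: succn_inj; rewrite -(size_prod_XsubC (croots a) id) -croots_prod.
by rewrite /cpoly_of_coefs size_map_poly size_poly_of_coefs.
Qed.

Definition Omega N : set (N.-tuple R) :=
  [set a | forall z : R[i], root (cpoly_of_coefs a) z -> `|z| <= 1].

(* Uniqueness is that of the root as a complex number: the dominant root may be
   multiple, which only happens on a Lebesgue-null set. *)
Definition OmegaP N : set (N.-tuple R) :=
  Omega (N:=N) `&` [set a | exists! z : R[i], root (cpoly_of_coefs a) z /\
    forall w : R[i], root (cpoly_of_coefs a) w -> `|w| <= `|z|].

Definition root_average (f : R[i] -> R) N (a : N.-tuple R) : R :=
  N%:R^-1 * \sum_(z <- croots a) f z.

Definition circle_average (f : R[i] -> R) : R :=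
  (2 * pi)^-1 *
  \int[lebesgue_measure]_(t in `[0, 2 * pi]) f (cos t +i* sin t)%C.

Definition normalized_lebesgue N (D A : set (N.-tuple R)) : \bar R :=
  (lebesgue_tuple N (A `&` D) / lebesgue_tuple N D)%E.

End RandomPolynomials.

Arguments Omega R N : clear implicits.
Arguments OmegaP R N : clear implicits.

(* Main.v *)
(** A monic real polynomial is coded by its reflection coefficients k_0, ...,
    k_(N-1), obtained by the Schur-Cohn recursion P_(i+1) = X P_i + k_i P_i^#,
    where P_i^# reverses the coefficients of P_i. Under Lebesgue measure they
    are independent: coordinate by coordinate the Jacobian is (1 - k_i^2)^floor(i/2),
    times 1 + k_i for odd i. Omega_N lies in the cube |k_i| <= 1.

    The m-th power sum of the roots is bounded by C_m times the sum of the
    |k_i|, and the product of the roots is k_(N-1) up to sign. Outside an event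
    of exponentially small relative measure the sum of the |k_i| is at most
    delta N and |k_(N-1)| at least exp(-delta N); then most roots are close to
    the circle and have small power sums, so the Weyl criterion, made effective
    by the Fejer kernel, applies.

    The volume of Omega^P_N is small only polynomially in N. If k_0 is slightly
    below -1 and |k_i| < 1 for i > 0, then exactly one root leaves the closed
    disk, and it stays below mu = 1 + 1/N^2. Dividing all roots by mu gives a
    polynomial in Omega^P_N, at the bounded cost mu^(N(N+1)/2) in volume. *)

From HB Require Import structures.
Require Import Defs.
From mathcomp Require Import all_boot all_order all_algebra.
From mathcomp Require Import all_classical all_reals all_analysis.
From mathcomp Require Import measurable_realfun complex.
From mathcomp Require Import ring lra zify.
Import Order.TTheory GRing.Theory Num.Theory.
Import numFieldNormedType.Exports.
Set Implicit Arguments.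
Unset Strict Implicit.
Unset Printing Implicit Defensive.
Local Open Scope classical_set_scope.
Local Open Scope ring_scope.

(** * Integration over tuples *)

Section TupleIntegral.
Context {R : realType}.
Local Notation mR := (measurableTypeR R).
Local Notation leb := (@lebesgue_measure R).
Local Open Scope ereal_scope.

Lemma ge0_integral_affine (c d : R) (h : mR -> \bar R) :
  (0 < c)%R -> measurable_fun setT h -> (forall x, 0 <= h x) ->
  \int[leb]_x h (c * x + d)%R = (c^-1)%:E * \int[leb]_x h x.
Proof.
move=> c0 mh h0.
pose phi (x : mR) : mR := (c * x + d)%R.
have mphi : measurable_fun setT phi.
  by apply: measurable_funD => //; apply: measurable_funM.
pose nu0 := [the measure _ _ of pushforward leb phi].
pose nu := nu0 mphi.
have cnn : (0 <= c)%R by exact: ltW.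
have E A : measurable A -> leb A = mscale (NngNum cnn) nu A.
  apply: lebesgue_measure_unique => X [[a b]] _ <-.
  transitivity (c%:E * leb (phi @^-1` `]a, b]%classic)); last by [].
  rewrite (_ : phi @^-1` _ = `]((a - d) / c)%R, ((b - d) / c)%R]%classic); last first.
    apply/seteqP; split=> x /=; rewrite !in_itv/= ltr_pdivrMr// ler_pdivlMr//
      /phi (mulrC x) ltrBlDr lerBrDr//.
  rewrite !lebesgue_measure_itv /= !lte_fin ltr_pM2r ?invr_gt0// ltrD2r.
  case: ifPn => ab; last by rewrite mule0.
  by rewrite -EFinM; congr EFin; field; rewrite gt_eqF.
rewrite [X in _ = _ * X](@eq_measure_integral _ _ _ setT (mscale (NngNum cnn) nu)); last first.
  by move=> A mA _; exact: E.
rewrite ge0_integral_mscale//= muleA -EFinM mulVf ?gt_eqF// mul1e.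
by rewrite ge0_integral_pushforward//.
Qed.

Lemma measurable_nth n i : measurable_fun setT (fun t : n.-tuple mR => nth 0%R t i : mR).
Proof.
have [ni|ni] := leqP n i.
  rewrite (_ : (fun _ => _) = cst 0%R)//; apply/funext => t.
  by rewrite nth_default// size_tuple.
rewrite (_ : (fun _ => _) = (fun t => tnth t (Ordinal ni))).
  exact: measurable_tnth.
by apply/funext => t; rewrite (tnth_nth 0%R).
Qed.

Lemma measurable_tuple_nthP d (T : measurableType d) n (f : T -> n.-tuple mR) :
  (forall i, (i < n)%N -> measurable_fun setT (fun x => nth 0%R (f x) i : mR)) ->
  measurable_fun setT f.
Proof.
move=> H; apply/measurable_fun_tnthP => i.
rewrite (_ : _ \o _ = fun x => nth 0%R (f x) i); first exact: H.
by apply/funext => x /=; rewrite (tnth_nth 0%R).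
Qed.

Lemma measurable_comp_nth d (T : measurableType d) n i (f : T -> n.-tuple mR) :
  measurable_fun setT f -> measurable_fun setT (fun x => nth 0%R (f x) i : mR).
Proof. by move=> mf; exact: (measurableT_comp (measurable_nth i) mf). Qed.

Lemma measurable_rcons d (T : measurableType d) n (g : T -> n.-tuple mR) (f : T -> mR) :
  measurable_fun setT g -> measurable_fun setT f ->
  measurable_fun setT (fun x => [tuple of rcons (g x) (f x)] : n.+1.-tuple mR).
Proof.
move=> mg mf; apply: measurable_tuple_nthP => i ilt.
under eq_fun do rewrite nth_rcons size_tuple.
case: ltngtP => _; [exact: (measurable_comp_nth i mg)|exact: measurable_cst|exact: mf].
Qed.

Lemma ge0_integral_tuple_cons n (F : n.+1.-tuple mR -> \bar R) :
  measurable_fun setT F -> (forall t, 0 <= F t) ->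
  \int[lebesgue_tuple n.+1]_t F t =
  \int[leb]_x \int[lebesgue_tuple n]_t F [tuple of x :: t].
Proof.
move=> mF F0.
transitivity (\int[pushforward (leb \x lebesgue_tuple n) (@cons_pair R n)]_t F t); first by [].
rewrite ge0_integral_pushforward//; last exact: measurable_cons_pair.
rewrite preimage_setT fubini_tonelli1//.
  exact: (measurableT_comp mF (@measurable_cons_pair _ _)).
by move=> x /=.
Qed.

Lemma measurable_integral_tuple d (T : measurableType d) n (F : T * n.-tuple mR -> \bar R) :
  measurable_fun setT F -> (forall t, 0 <= F t) ->
  measurable_fun setT (fun x => \int[lebesgue_tuple n]_t F (x, t)).
Proof. by move=> mF F0; apply: measurable_fun_fubini_tonelli_F. Qed.

Lemma measurable_integral_lebesgue d (T : measurableType d) (F : T * mR -> \bar R) :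
  measurable_fun setT F -> (forall t, 0 <= F t) ->
  measurable_fun setT (fun x => \int[leb]_y F (x, y)).
Proof. by move=> mF F0; apply: measurable_fun_fubini_tonelli_F. Qed.

Lemma ge0_integral_tuple0 (F : 0.-tuple mR -> \bar R) :
  measurable_fun setT F -> (forall t, 0 <= F t) ->
  \int[lebesgue_tuple 0]_t F t = F [tuple].
Proof.
move=> mF F0.
transitivity (\int[\d_([tuple] : 0.-tuple mR)]_t F t); first by [].
by rewrite integral_dirac// diracT mul1e.
Qed.

Lemma ge0_integral_tuple_rcons n (F : n.+1.-tuple mR -> \bar R) :
  measurable_fun setT F -> (forall t, 0 <= F t) ->
  \int[lebesgue_tuple n.+1]_t F t =
  \int[leb]_k \int[lebesgue_tuple n]_t F [tuple of rcons t k].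
Proof.
elim: n F => [|n IH] F mF F0.
  rewrite (ge0_integral_tuple_cons mF F0); apply: eq_integral => x _.
  by apply: eq_integral => t _; congr F; apply/val_inj; rewrite /= (tuple0 t).
rewrite (ge0_integral_tuple_cons mF F0).
have mc d (T : measurableType d) (f : T -> mR) (g : T -> n.+1.-tuple mR) :
    measurable_fun setT f -> measurable_fun setT g ->
    measurable_fun setT (fun x => F [tuple of f x :: g x]).
  by move=> mf mg; apply: (measurableT_comp mF); exact: measurable_cons.
rewrite (eq_integral (fun x : mR => \int[leb]_k \int[lebesgue_tuple n]_t
    F [tuple of x :: [tuple of rcons t k]])); last first.
  by move=> x _; rewrite IH//; apply: mc.
have mG : measurable_fun setT (fun p : (mR * mR) * n.-tuple mR =>
    F [tuple of p.1.1 :: [tuple of rcons p.2 p.1.2]]).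
  apply: mc; first by apply: measurableT_comp => //; exact: measurable_fst.
  apply: measurable_rcons; first exact: measurable_snd.
  by apply: measurableT_comp => //; exact: measurable_fst.
rewrite (fubini_tonelli (m1 := leb) (m2 := leb) (fun p : mR * mR => \int[lebesgue_tuple n]_t
   F [tuple of p.1 :: [tuple of rcons t p.2]])); first last.
- by move=> p; apply: integral_ge0.
- exact: (measurable_integral_tuple mG).
apply: eq_integral => k _.
have mFk : measurable_fun setT (fun t : n.+1.-tuple mR => F [tuple of rcons t k]).
  by apply: (measurableT_comp mF); apply: measurable_rcons.
rewrite (ge0_integral_tuple_cons mFk); last by move=> t; exact: F0.
apply: eq_integral => x _; apply: eq_integral => t _.
by congr F; exact: val_inj.
Qed.

Lemma ge0_integral_tuple_cons_rcons n (F : n.+2.-tuple mR -> \bar R) :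
  measurable_fun setT F -> (forall t, 0 <= F t) ->
  \int[lebesgue_tuple n.+2]_t F t =
  \int[leb]_x \int[leb]_y \int[lebesgue_tuple n]_t
    F [tuple of x :: [tuple of rcons t y]].
Proof.
move=> mF F0; rewrite (ge0_integral_tuple_cons mF F0); apply: eq_integral => x _.
rewrite ge0_integral_tuple_rcons//.
by apply: (measurableT_comp mF); apply: measurable_cons.
Qed.

Lemma one_sub_sqr_gt0 (k : R) : (`|k| < 1 -> 0 < 1 - k ^+ 2)%R.
Proof. by rewrite ltr_norml => /andP[a b]; nra. Qed.

Lemma ge0_integral_mix2 (k : R) (G : mR * mR -> \bar R) : (`|k| < 1)%R ->
  measurable_fun setT G -> (forall p, 0 <= G p) ->
  \int[leb]_x \int[leb]_y G (x, y) = (1 - k ^+ 2)%:E *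
  \int[leb]_x \int[leb]_y G (x + k * y, y + k * x)%R.
Proof.
move=> k1 mG G0.
have d0 : (0 < 1 - k ^+ 2)%R by exact: one_sub_sqr_gt0.
have mp d (T : measurableType d) (f g : T -> mR) : measurable_fun setT f ->
   measurable_fun setT g -> measurable_fun setT (fun x => G (f x, g x)).
  move=> mf mg; apply: (measurableT_comp mG); exact/measurable_fun_pairP.
have mf1 : measurable_fun setT (fst : mR * mR -> mR) by [].
have mf2 : measurable_fun setT (snd : mR * mR -> mR) by [].
have mk (f : mR * mR -> mR) : measurable_fun setT f ->
    measurable_fun setT (fun p => k * f p : mR)%R.
  by move=> mf; apply: measurable_funM.
have mk1 (f : mR -> mR) : measurable_fun setT f ->
    measurable_fun setT (fun p => k * f p : mR)%R.
  by move=> mf; apply: measurable_funM.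
rewrite (fubini_tonelli (m1 := leb) (m2 := leb)
  (fun p : mR * mR => G (p.1 + k * p.2, p.2 + k * p.1)%R)); first last.
- by move=> p.
- by apply: mp; apply: measurable_funD => //; exact: mk.
transitivity ((1 - k ^+ 2)%:E * \int[leb]_y \int[leb]_x
   G (x, (1 - k ^+ 2) * y + k * x)%R); last first.
  congr (_ * _); apply: eq_integral => y _ /=.
  rewrite -[LHS]mul1e -{1}invr1.
  rewrite -(@ge0_integral_affine 1 (k * y) (fun x => G (x, (1 - k ^+ 2) * y + k * x)%R))//; last first.
    by apply: mp => //; apply: measurable_funD => //; exact: mk1.
  apply: eq_integral => x _.
  have e1 (u v : R) : (1 * u + k * v = u + k * v)%R by ring.
  have e2 (u v : R) : ((1 - k ^+ 2) * v + k * (1 * u + k * v) = v + k * u)%R by ring.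
  by congr (G (_, _)); [exact: e1|exact: e2].
transitivity ((1 - k ^+ 2)%:E * \int[leb]_x \int[leb]_y
   G (x, (1 - k ^+ 2) * y + k * x)%R); last first.
  rewrite (fubini_tonelli (m1 := leb) (m2 := leb)
    (fun p : mR * mR => G (p.1, (1 - k ^+ 2) * p.2 + k * p.1)%R))//.
  apply: mp => //; apply: measurable_funD; last exact: mk.
  exact: measurable_funM.
rewrite -ge0_integralZl//; first last.
- by rewrite lee_fin ltW.
- by move=> x _; exact: integral_ge0.
- apply: (@measurable_fun_fubini_tonelli_F _ _ _ _ R leb
    (fun p : mR * mR => G (p.1, (1 - k ^+ 2) * p.2 + k * p.1)%R)) => //.
  apply: mp => //; apply: measurable_funD; last exact: mk.
  exact: measurable_funM.
apply: eq_integral => x _ /=.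
rewrite (@ge0_integral_affine _ _ (fun y => G (x, y)))//; last exact: mp.
by rewrite muleA -EFinM divff ?gt_eqF// mul1e.
Qed.

Definition mix (k : R) (s : seq R) : seq R :=
  [seq p.1 + k * p.2 | p <- zip s (rev s)]%R.
Definition unmix (k : R) (s : seq R) : seq R :=
  [seq (p.1 - k * p.2) / (1 - k ^+ 2) | p <- zip s (rev s)]%R.

Lemma size_mix k s : size (mix k s) = size s.
Proof. by rewrite size_map size_zip size_rev minnn. Qed.
Lemma size_unmix k s : size (unmix k s) = size s.
Proof. by rewrite size_map size_zip size_rev minnn. Qed.

Lemma mix_tupleP n k (t : n.-tuple R) : size (mix k t) == n.
Proof. by rewrite size_mix size_tuple. Qed.
Canonical mix_tuple n k (t : n.-tuple R) := Tuple (mix_tupleP k t).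
Lemma unmix_tupleP n k (t : n.-tuple R) : size (unmix k t) == n.
Proof. by rewrite size_unmix size_tuple. Qed.
Canonical unmix_tuple n k (t : n.-tuple R) := Tuple (unmix_tupleP k t).

Lemma nth_mix k s i : (i < size s)%N ->
  nth 0%R (mix k s) i = (nth 0 s i + k * nth 0 (rev s) i)%R.
Proof.
move=> h; rewrite (nth_map (0, 0)%R) ?size_zip ?size_rev ?minnn//.
by rewrite nth_zip ?size_rev.
Qed.
Lemma nth_unmix k s i : (i < size s)%N ->
  nth 0%R (unmix k s) i = ((nth 0 s i - k * nth 0 (rev s) i) / (1 - k ^+ 2))%R.
Proof.
move=> h; rewrite (nth_map (0, 0)%R) ?size_zip ?size_rev ?minnn//.
by rewrite nth_zip ?size_rev.
Qed.

Lemma mix_rev k s : mix k (rev s) = rev (mix k s).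
Proof.
apply: (@eq_from_nth _ 0%R); first by rewrite size_rev !size_mix size_rev.
move=> i; rewrite size_mix size_rev => h.
rewrite nth_mix ?size_rev// revK !nth_rev ?size_mix// nth_mix; last first.
  by case: (size s) h => // n h; rewrite subSS ltnS leq_subr.
rewrite nth_rev; last by case: (size s) h => // n h; rewrite subSS ltnS leq_subr.
congr (_ + k * nth _ _ _)%R; case: (size s) h => // n h; rewrite !subSS.
by rewrite subKn.
Qed.

Lemma mixK k s : (1 - k ^+ 2 != 0)%R -> unmix k (mix k s) = s.
Proof.
move=> k1; apply: (@eq_from_nth _ 0%R); first by rewrite size_unmix size_mix.
move=> i; rewrite size_unmix size_mix => h.
rewrite nth_unmix ?size_mix// -mix_rev !nth_mix ?size_rev// revK.
by field.
Qed.

Lemma unmix_rev k s : unmix k (rev s) = rev (unmix k s).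
Proof.
apply: (@eq_from_nth _ 0%R); first by rewrite size_rev !size_unmix size_rev.
move=> i; rewrite size_unmix size_rev => h.
rewrite nth_unmix ?size_rev// revK !nth_rev ?size_unmix// nth_unmix; last first.
  by case: (size s) h => // n h; rewrite subSS ltnS leq_subr.
rewrite nth_rev; last by case: (size s) h => // n h; rewrite subSS ltnS leq_subr.
congr ((_ - k * nth _ _ _) / _)%R; case: (size s) h => // n h; rewrite !subSS.
by rewrite subKn.
Qed.

Lemma unmixK k s : (1 - k ^+ 2 != 0)%R -> mix k (unmix k s) = s.
Proof.
move=> k1; apply: (@eq_from_nth _ 0%R); first by rewrite size_mix size_unmix.
move=> i; rewrite size_mix size_unmix => h.
rewrite nth_mix ?size_unmix// -unmix_rev !nth_unmix ?size_rev// revK.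
by field.
Qed.

Lemma mix_cons_rcons k x y s :
  mix k (x :: rcons s y) = (x + k * y)%R :: rcons (mix k s) (y + k * x)%R.
Proof.
rewrite /mix rev_cons rev_rcons rcons_cons /= zip_rcons ?size_rev//.
by rewrite map_rcons.
Qed.

(* The determinant of [mix k]: 1 - k^2 for each pair of mirrored entries, and
   1 + k for the middle entry when there is one. *)
Definition mix_jacobian n (k : R) : R :=
  ((1 - k ^+ 2) ^+ n./2 * (1 + k) ^+ odd n)%R.

Lemma measurable_mix n k :
  measurable_fun setT (fun t : n.-tuple mR => [tuple of mix k t] : n.-tuple mR).
Proof.
apply: measurable_tuple_nthP => i ilt.
under eq_fun do rewrite nth_mix ?size_tuple//.
apply: measurable_funD; first exact: measurable_nth.
apply: measurable_funM => //.
under eq_fun do rewrite nth_rev ?size_tuple//.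
exact: measurable_nth.
Qed.

Lemma ge0_integral_mix n (k : R) (F : n.-tuple mR -> \bar R) : (`|k| < 1)%R ->
  measurable_fun setT F -> (forall t, 0 <= F t) ->
  \int[lebesgue_tuple n]_t F t = (mix_jacobian n k)%:E *
    \int[lebesgue_tuple n]_t F [tuple of mix k t].
Proof.
move=> k1.
have kp : (0 < 1 + k)%R by move: k1; rewrite ltr_norml => /andP[]; lra.
elim/ltn_ind: n F => -[_|[_|n IH]] F mF F0.
- rewrite /mix_jacobian /= !expr0 mulr1 mul1e; apply: eq_integral => t _.
  by congr F; rewrite [LHS]tuple0 [RHS]tuple0.
- rewrite /mix_jacobian /= expr0 mul1r expr1.
  rewrite !ge0_integral_tuple_cons//; last exact: (measurableT_comp mF (measurable_mix _)).
  have mc x : measurable_fun setT (fun t : 0.-tuple mR => F [tuple of x :: t]).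
    by apply: (measurableT_comp mF); apply: measurable_cons.
  have mcm x : measurable_fun setT (fun t : 0.-tuple mR => F [tuple of mix k [tuple of x :: t]]).
    by apply: (measurableT_comp mF); apply: (measurableT_comp (measurable_mix _)); apply: measurable_cons.
  rewrite (eq_integral (fun x : mR => F [tuple x])); last first.
    by move=> x _; rewrite ge0_integral_tuple0//; congr F; exact: val_inj.
  rewrite [in RHS](eq_integral (fun x : mR => F [tuple ((1 + k) * x + 0)%R])); last first.
    move=> x _; rewrite ge0_integral_tuple0//; congr F; apply/val_inj => /=.
    have e (u : R) : (u + k * u = (1 + k) * u + 0)%R by ring.
    by rewrite /mix/= [in LHS]e.
  rewrite (@ge0_integral_affine (1 + k) 0 (fun x => F [tuple x]))//; last first.
    by apply: (measurableT_comp mF); apply: measurable_cons.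
  by rewrite muleA -EFinM divff ?gt_eqF// mul1e.
- rewrite ge0_integral_tuple_cons_rcons//.
  rewrite [in RHS]ge0_integral_tuple_cons_rcons//; last first.
    exact: (measurableT_comp mF (measurable_mix _)).
  pose G (p : mR * mR) := \int[lebesgue_tuple n]_t F [tuple of p.1 :: [tuple of rcons t p.2]].
  have mG : measurable_fun setT G.
    apply: (@measurable_integral_tuple _ _ _ (fun q : (mR * mR) * n.-tuple mR =>
        F [tuple of q.1.1 :: [tuple of rcons q.2 q.1.2]])) => //.
    apply: (measurableT_comp mF); apply: measurable_cons.
      by apply: measurableT_comp => //; exact: measurable_fst.
    apply: measurable_rcons; first exact: measurable_snd.
    by apply: measurableT_comp => //; exact: measurable_fst.
  have G0 p : 0 <= G p by exact: integral_ge0.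
  rewrite (ge0_integral_mix2 k1 mG G0).
  have D0 : (0 < mix_jacobian n k)%R.
    by rewrite mulr_gt0 ?exprn_gt0// one_sub_sqr_gt0.
  have mFF x y : measurable_fun setT (fun t : n.-tuple mR => F [tuple of x :: [tuple of rcons t y]]).
    apply: (measurableT_comp mF); apply: measurable_cons => //.
    by apply: measurable_rcons.
  rewrite (_ : mix_jacobian n.+2 k = (1 - k ^+ 2) * mix_jacobian n k)%R; last first.
    by rewrite /mix_jacobian /= negbK exprS mulrA.
  rewrite EFinM -muleA; congr (_ * _).
  have mpr (f : mR * mR -> mR) (c : R) : measurable_fun setT f ->
      measurable_fun setT (fun p => c * f p : mR)%R.
    by move=> mf; apply: measurable_funM.
  pose G' (p : mR * mR) := \int[lebesgue_tuple n]_t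
    F [tuple of mix k [tuple of p.1 :: [tuple of rcons t p.2]]].
  have GG' p : G (p.1 + k * p.2, p.2 + k * p.1)%R = (mix_jacobian n k)%:E * G' p.
    rewrite /G /G' (IH n) => //=; congr (_ * _); apply: eq_integral => t _.
    by congr F; apply/val_inj; rewrite /= mix_cons_rcons.
  have mG' : measurable_fun setT G'.
    apply: (@measurable_integral_tuple _ _ _ (fun q : (mR * mR) * n.-tuple mR =>
        F [tuple of mix k [tuple of q.1.1 :: [tuple of rcons q.2 q.1.2]]])) => //.
    apply: (measurableT_comp mF); apply: (measurableT_comp (measurable_mix _)).
    apply: measurable_cons.
      by apply: measurableT_comp => //; exact: measurable_fst.
    apply: measurable_rcons; first exact: measurable_snd.
    by apply: measurableT_comp => //; exact: measurable_fst.
  have G'0 p : 0 <= G' p by exact: integral_ge0.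
  transitivity ((mix_jacobian n k)%:E * \int[leb]_x \int[leb]_y G' (x, y)); last by [].
  clearbody G G'.
  rewrite -ge0_integralZl//; first last.
  + by rewrite lee_fin ltW.
  + by move=> x _; apply: integral_ge0.
  + exact: measurable_integral_lebesgue.
  apply: eq_integral => x _.
  rewrite -ge0_integralZl//; first last.
  + by rewrite lee_fin ltW.
  + exact: (measurableT_comp mG' (measurable_pair1 x)).
  by apply: eq_integral => y _; rewrite (GG' (x, y)).
Qed.

Lemma lebesgue_tuple_mono n (A B : set (n.-tuple mR)) :
  A `<=` B -> lebesgue_tuple n A <= lebesgue_tuple n B.
Proof.
elim: n A B => [|n IH] A B AB.
  change ((\d_([tuple] : 0.-tuple mR) A : \bar R) <= \d_([tuple] : 0.-tuple mR) B).
  rewrite !diracE lee_fin ler_nat.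
  by case: (boolP (_ \in A)) => // /set_mem/AB/mem_set ->.
change (\int[leb]_x (lebesgue_tuple n (xsection (@cons_pair R n @^-1` A) x)) <=
  \int[leb]_x (lebesgue_tuple n (xsection (@cons_pair R n @^-1` B) x))).
rewrite !ge0_integralTE//.
apply: le_ereal_sup => _ [h hA <-]; exists h => // x.
apply: (le_trans (hA x)); apply: IH => y; rewrite /xsection/= !inE/=.
by move/AB.
Qed.

End TupleIntegral.

(** * Independence of the reflection coefficients *)

Section Refl.
Context {R : realType}.
Local Notation mR := (measurableTypeR R).
Local Notation leb := (@lebesgue_measure R).

Lemma measurable_inv : measurable_fun setT (fun x : R => x^-1).
Proof.
rewrite (_ : (fun x : R => x^-1) = (fun x => if x == 0 then 0 else x^-1)); last first.
  by apply/funext => x; case: eqP => // ->; rewrite invr0.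
apply: measurable_fun_if => //; first exact: measurable_fun_eqr.
rewrite setTI (_ : _ @^-1` _ = [set x : R | x != 0]); last first.
  by apply/seteqP; split=> x /=; case: eqP.
apply: open_continuous_measurable_fun; first exact: open_neq.
by move=> x; rewrite inE /= => x0; exact: inv_continuous.
Qed.

(* The reflection coefficients (Schur-Cohn parameters) of the monic polynomial
   with lower coefficients [s]; junk below an index with |k| = 1. *)
Fixpoint refl n (s : seq R) : seq R :=
  if n is m.+1 then rcons (refl m (unmix (nth 0 s m) (take m s))) (nth 0 s m)
  else [::].

Lemma size_refl n s : size (refl n s) = n.
Proof. by elim: n s => //= n IH s; rewrite size_rcons IH. Qed.

Lemma refl_rcons n (s : seq R) k : size s = n ->
  refl n.+1 (rcons s k) = rcons (refl n (unmix k s)) k.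
Proof.
by move=> <-; rewrite /= nth_rcons ltnn eqxx -[rcons s k]cats1 take_size_cat.
Qed.

Lemma measurable_nth_refl d (T : measurableType d) n (f : T -> seq R) :
  (forall x, size (f x) = n) ->
  (forall i, measurable_fun setT (fun x => nth 0 (f x) i)) ->
  forall i, measurable_fun setT (fun x => nth 0 (refl n (f x)) i).
Proof.
elim: n f => [|n IH] f sf mf i.
  by rewrite (_ : (fun _ => _) = cst 0)//; apply/funext => x; rewrite /= nth_nil.
rewrite /=; under eq_fun do rewrite nth_rcons size_refl.
have [iltn|igtn|ien] := ltngtP i n; [|exact: measurable_cst|exact: mf].
apply: (IH (fun x => unmix (nth 0 (f x) n) (take n (f x)))) => [x|j].
  by rewrite size_unmix size_takel// sf.
have st x : size (take n (f x)) = n by rewrite size_takel// sf.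
have [jn|jn] := ltnP j n; last first.
  rewrite (_ : (fun _ => _) = cst 0)//; apply/funext => x.
  by rewrite nth_default// size_unmix st.
have jn' : (n - j.+1 < n)%N by lia.
rewrite (_ : (fun _ => _) = fun x => (nth 0 (f x) j - nth 0 (f x) n * nth 0 (f x) (n - j.+1)) /
    (1 - nth 0 (f x) n ^+ 2)); last first.
  by apply/funext => x; rewrite nth_unmix ?st// nth_rev ?st// !nth_take.
apply: measurable_funM.
  by apply: measurable_funB => //; apply: measurable_funM.
apply: (measurableT_comp measurable_inv); apply: measurable_funB => //.
exact: measurable_funX.
Qed.

Definition refl_prod n (g : nat -> R -> R) (s : seq R) : R :=
  \prod_(i < n) g i (nth 0 (refl n s) i).

Lemma refl_prod_rcons n g (s : seq R) k : size s = n ->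
  refl_prod n.+1 g (rcons s k) = g n k * refl_prod n g (unmix k s).
Proof.
move=> sn; rewrite /refl_prod big_ord_recr /= mulrC; congr (_ * _).
  by rewrite nth_rcons size_refl ltnn eqxx nth_rcons sn ltnn eqxx.
apply: eq_bigr => i _; rewrite -/(refl n.+1 (rcons s k)) refl_rcons//.
by rewrite nth_rcons size_refl ltn_ord.
Qed.

Variable g : nat -> R -> R.
Hypothesis mg : forall i, measurable_fun setT (g i).
Hypothesis g0 : forall i k, 0 <= g i k.
Hypothesis gout : forall i k, (0 < i)%N -> 1 < `|k| -> g i k = 0.

Lemma refl_prod_ge0 n s : 0 <= refl_prod n g s.
Proof. by apply: prodr_ge0. Qed.

Lemma measurable_refl_prod d (T : measurableType d) n (f : T -> seq R) :
  (forall x, size (f x) = n) ->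
  (forall i, measurable_fun setT (fun x => nth 0 (f x) i)) ->
  measurable_fun setT (fun x => refl_prod n g (f x)).
Proof.
move=> sf mf; apply: measurable_prod => i _.
apply: (measurableT_comp (mg i)); exact: measurable_nth_refl.
Qed.

Lemma mix_jacobian_ge0 n (k : R) : `|k| <= 1 -> 0 <= mix_jacobian n k.
Proof.
rewrite ler_norml => /andP[a b]; rewrite /mix_jacobian mulr_ge0// exprn_ge0//; last by lra.
nra.
Qed.

Lemma gjac_ge0 n k : 0 <= g n k * mix_jacobian n k.
Proof.
have [k1|k1] := leP `|k| 1; first by rewrite mulr_ge0// mix_jacobian_ge0.
case: n => [|n]; last by rewrite gout// mul0r.
by rewrite /mix_jacobian /= !expr0 !mulr1.
Qed.

Lemma measurable_gjac n : measurable_fun setT (fun k : R => g n k * mix_jacobian n k).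
Proof.
apply: measurable_funM => //; apply: measurable_funM.
  by apply: measurable_funX; apply: measurable_funB => //; exact: measurable_funX.
by apply: measurable_funX; apply: measurable_funD.
Qed.

Local Open Scope ereal_scope.

Lemma integral_refl_prod n :
  \int[lebesgue_tuple n]_t (refl_prod n g t)%:E =
  \prod_(i < n) \int[leb]_k (g i k * mix_jacobian i k)%:E.
Proof.
have mrp m : measurable_fun setT (fun t : m.-tuple mR => (refl_prod m g t)%:E).
  apply/measurable_EFinP; apply: (@measurable_refl_prod _ _ m (fun t : m.-tuple mR => t)).
    by move=> t; exact: size_tuple.
  by move=> i; exact: measurable_nth.
have rp0 m (t : seq R) : 0 <= (refl_prod m g t)%:E by rewrite lee_fin refl_prod_ge0.
elim: n => [|n IH].
  rewrite (ge0_integral_tuple0 (mrp 0%N)); last by move=> t; exact: rp0.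
  by rewrite /refl_prod !big_ord0.
transitivity (\prod_(i < n) (\int[leb]_k (g i k * mix_jacobian i k)%:E) *
  \int[leb]_k (g n k * mix_jacobian n k)%:E); last by rewrite big_ord_recr.
rewrite -IH.
rewrite (ge0_integral_tuple_rcons (mrp n.+1)); last by move=> t; exact: rp0.
set C := \int[lebesgue_tuple n]_t (refl_prod n g t)%:E.
have C0 : 0 <= C by apply: integral_ge0 => t _; exact: rp0.
have mjoint : measurable_fun setT (fun p : mR * n.-tuple mR =>
    (refl_prod n.+1 g [tuple of rcons p.2 p.1])%:E).
  apply: (measurableT_comp (mrp n.+1)); apply: measurable_rcons.
    exact: measurable_snd.
  exact: measurable_fst.
rewrite muleC -ge0_integralZr//; first last.
- by move=> k _; rewrite lee_fin; exact: gjac_ge0.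
- by apply/measurable_EFinP; exact: (measurable_gjac n).
apply: ge0_ae_eq_integral => //.
- by apply: (measurable_integral_tuple mjoint) => p; exact: rp0.
- by apply: emeasurable_funM => //; apply/measurable_EFinP; exact: (measurable_gjac n).
- by move=> k _; apply: integral_ge0 => t _; exact: rp0.
- by move=> k _; rewrite mule_ge0// lee_fin; exact: gjac_ge0.
exists ([set 1%R] `|` [set (-1)%R]); split.
- by apply: measurableU; exact: measurable_set1.
- apply/eqP; rewrite eq_le measure_ge0 andbT.
  rewrite (le_trans (measureU2 _ _ _))//; try exact: measurable_set1.
  have e (x : R) : leb [set x] = 0 by exact: lebesgue_measure_set1.
  by rewrite [X in X + _ <= _]e [X in _ + X <= _]e adde0.
move=> k /=; apply: contra_notP => /not_orP[/eqP k1 /eqP k2] _.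
rewrite (eq_integral (fun t : n.-tuple mR => (g n k)%:E * (refl_prod n g (unmix k t))%:E)); last first.
  by move=> t _; rewrite refl_prod_rcons ?size_tuple// EFinM.
have mun : measurable_fun setT (fun t : n.-tuple mR => (refl_prod n g (unmix k t))%:E).
  apply/measurable_EFinP; apply: (@measurable_refl_prod _ _ n (fun t : n.-tuple mR => unmix k t)).
    by move=> t; rewrite size_unmix size_tuple.
  move=> i.
  have [ilt|ige] := ltnP i n; last first.
    rewrite (_ : (fun _ => _) = cst 0%R)//; apply/funext => t.
    by rewrite nth_default// size_unmix size_tuple.
  under eq_fun do rewrite nth_unmix ?size_tuple// nth_rev ?size_tuple//.
  apply: measurable_funM => //; apply: measurable_funB; first exact: measurable_nth.
  by apply: measurable_funM => //; exact: measurable_nth.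
rewrite ge0_integralZl//; last by rewrite lee_fin; exact: g0.
rewrite EFinM -muleA; case: n @C IH C0 mjoint mun => [|n] C IH C0 mjoint mun.
  rewrite /mix_jacobian /= !expr0 mulr1 mul1e; congr (_ * _).
have [k1'|k1'] := leP `|k|%R 1%R; last by rewrite gout// !mul0e.
have {}k1' : (`|k| < 1)%R.
  by rewrite lt_neqAle k1' andbT; apply/eqP => /eqP; rewrite eqr_norml (negbTE k1) (negbTE k2).
congr (_ * _); rewrite /C (ge0_integral_mix k1' mun); last by move=> t; exact: rp0.
congr (_ * _); apply: eq_integral => t _.
by rewrite /= mixK// gt_eqF// one_sub_sqr_gt0.
Qed.

End Refl.

(** * Rescaling of the roots *)

Section Scale.
Context {R : realType}.
Local Notation mR := (measurableTypeR R).

Fixpoint wscale (w : nat -> R) (s : seq R) : seq R :=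
  if s is x :: s' then w 0%N * x :: wscale (fun i => w i.+1) s' else [::].

Lemma size_wscale w s : size (wscale w s) = size s.
Proof. by elim: s w => //= x s IH w; rewrite IH. Qed.

Lemma wscale_tupleP n w (t : n.-tuple R) : size (wscale w t) == n.
Proof. by rewrite size_wscale size_tuple. Qed.
Canonical wscale_tuple n w (t : n.-tuple R) := Tuple (wscale_tupleP w t).

Lemma nth_wscale w s i : nth 0 (wscale w s) i = w i * nth 0 s i.
Proof.
elim: s w i => [|x s IH] w [|i] //=; rewrite ?nth_nil ?mulr0//.
exact: IH.
Qed.

Lemma measurable_wscale n w :
  measurable_fun setT (fun t : n.-tuple mR => [tuple of wscale w t] : n.-tuple mR).
Proof.
apply: measurable_tuple_nthP => i ilt.
under eq_fun do rewrite nth_wscale.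
by apply: measurable_funM => //; exact: measurable_nth.
Qed.

Local Open Scope ereal_scope.

Lemma ge0_integral_wscale n (w : nat -> R) (F : n.-tuple mR -> \bar R) :
  (forall i, 0 < w i)%R ->
  measurable_fun setT F -> (forall t, 0 <= F t) ->
  \int[lebesgue_tuple n]_t F t = (\prod_(i < n) w i)%:E *
    \int[lebesgue_tuple n]_t F [tuple of wscale w t].
Proof.
elim: n w F => [|n IH] w F w0 mF F0.
  rewrite big_ord0 mul1e; apply: eq_integral => t _; congr F; apply/val_inj.
  by rewrite /= (tuple0 t).
have mFw : measurable_fun setT (fun t : n.+1.-tuple mR => F [tuple of wscale w t]).
  exact: (measurableT_comp mF (measurable_wscale w)).
rewrite (ge0_integral_tuple_cons mF F0) (ge0_integral_tuple_cons mFw); last by move=> t; exact: F0.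
pose w' i := w i.+1.
pose G (x : mR) := \int[lebesgue_tuple n]_t F [tuple of x :: [tuple of wscale w' t]].
have mjoint : measurable_fun setT (fun p : mR * n.-tuple mR =>
    F [tuple of p.1 :: [tuple of wscale w' p.2]]).
  apply: (measurableT_comp mF); apply: measurable_cons; first exact: measurable_fst.
  by apply: (measurableT_comp (measurable_wscale w')); exact: measurable_snd.
have mG : measurable_fun setT G by exact: (measurable_integral_tuple mjoint).
have G0 x : 0 <= G x by apply: integral_ge0.
have W0 : (0 < \prod_(i < n) w' i)%R by apply: prodr_gt0 => i _; exact: w0.
rewrite (eq_integral (fun x : mR => (\prod_(i < n) w' i)%:E * G x)); last first.
  move=> x _; have mFx : measurable_fun setT (fun t : n.-tuple mR => F [tuple of x :: t]).
    by apply: (measurableT_comp mF); apply: measurable_cons.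
  by rewrite (IH w' _ _ mFx) => // i; exact: w0.
rewrite ge0_integralZl; [|exact: measurableT|exact: mG|by move=> x _; exact: G0|by rewrite lee_fin ltW].
rewrite [in RHS](eq_integral (fun x : mR => G (w 0%N * x + 0)%R)); last first.
  move=> x _; apply: eq_integral => t _; congr F; apply/val_inj => /=.
  by rewrite addr0.
rewrite (@ge0_integral_affine _ _ _ G)//.
rewrite muleA -EFinM big_ord_recl; congr (_%:E * _).
by rewrite mulrAC divff ?mul1r// gt_eqF.
Qed.

End Scale.

(** * Polynomials and their reversals *)

Section Pol.
Context {R : realType}.
Local Notation C := R[i].
Local Notation toC := (real_complex R).
Implicit Types s b : seq R.

(* [rpol s] is X^n pol(1/X), n the length of [s]. *)
Definition pol s : {poly R} := Poly (rev (1 :: s)).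
Definition rpol s : {poly R} := Poly (1 :: s).
Definition cpol s : {poly C} := map_poly toC (pol s).
Definition crpol s : {poly C} := map_poly toC (rpol s).

Lemma pol_rcons_mix k s : pol (rcons (mix k s) k) = 'X * pol s + k *: rpol s.
Proof.
apply/polyP => i; rewrite coefD coefZ coefXM !coef_Poly !rev_cons rev_rcons.
case: i => [|i]; first by rewrite /= mulr1 add0r.
rewrite /= !nth_rcons !size_rev size_mix.
case: (ltngtP i (size s)) => h.
- by rewrite -mix_rev nth_mix ?size_rev// revK.
- by rewrite nth_default ?mulr0 ?addr0// ltnW.
- by rewrite h nth_default ?mulr0 ?addr0.
Qed.

Lemma rpol_rcons_mix k s : rpol (rcons (mix k s) k) = rpol s + k *: ('X * pol s).
Proof.
apply/polyP => i; rewrite coefD coefZ coefXM !coef_Poly !rev_cons.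
case: i => [|i]; first by rewrite /= mulr0 addr0.
rewrite /= !nth_rcons !size_rev size_mix.
case: (ltngtP i (size s)) => h.
- by rewrite nth_mix.
- by rewrite nth_default ?mulr0 ?addr0// ltnW.
- by rewrite h nth_default ?add0r ?mulr1.
Qed.

Lemma poly_of_coefs_pol n (a : n.-tuple R) : poly_of_coefs a = pol a.
Proof.
apply/polyP => i; rewrite /poly_of_coefs coefD coefXn coef_sum coef_Poly rev_cons.
rewrite nth_rcons size_rev size_tuple.
case: (ltngtP i n) => h.
- rewrite add0r nth_rev ?size_tuple//.
  have hj : (n - i.+1 < n)%N by lia.
  rewrite (bigD1 (Ordinal hj))//= coefZ coefXn big1 ?addr0.
    by rewrite (tnth_nth 0)/= (_ : (i == _) = true) ?mulr1//; apply/eqP; lia.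
  move=> j; rewrite -val_eqE /= => jn; rewrite coefZ coefXn.
  rewrite (_ : (i == _) = false) ?mulr0//; apply/eqP; have := ltn_ord j; move/eqP : jn; lia.
- rewrite big1 ?addr0// => j _; rewrite coefZ coefXn.
  by rewrite (_ : (i == _) = false) ?mulr0//; apply/eqP; have := ltn_ord j; lia.
- rewrite big1 ?addr0// => j _; rewrite coefZ coefXn.
  by rewrite (_ : (i == _) = false) ?mulr0//; apply/eqP; have := ltn_ord j; lia.
Qed.

Lemma cpoly_of_coefs_pol n (a : n.-tuple R) : cpoly_of_coefs a = cpol a.
Proof. by rewrite /cpoly_of_coefs poly_of_coefs_pol. Qed.

Lemma horner_Poly_rev (F : fieldType) (l : seq F) x : x != 0 ->
  (Poly l).[x] * x = x ^+ size l * (Poly (rev l)).[x^-1].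
Proof.
move=> x0; rewrite !horner_Poly.
elim: l => [|c l IH] /=; first by rewrite mul0r mulr0.
rewrite rev_cons -cats1.
have -> l1 : horner_rec (l1 ++ [:: c]) x^-1 = horner_rec l1 x^-1 + c * x^-1 ^+ size l1.
  elim: l1 => [|d l1 IH1] /=; first by rewrite mul0r !add0r mulr1.
  by rewrite IH1 exprS; ring.
rewrite mulrDl IH size_rev exprS exprVn; field.
by rewrite expf_neq0.
Qed.

Lemma cpolE s : cpol s = Poly (rev (1 :: [seq toC x | x <- s])).
Proof.
apply/polyP => i; rewrite coef_map /= !coef_Poly !rev_cons -map_rev !nth_rcons size_map.
case: ltngtP => // h; first by rewrite (nth_map 0).
Qed.

Lemma crpolE s : crpol s = Poly (1 :: [seq toC x | x <- s]).
Proof.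
apply/polyP => -[|j]; rewrite coef_map !coef_Poly /=; first by [].
have [h|h] := ltnP j (size s); first by rewrite (nth_map 0).
by rewrite !nth_default ?size_map.
Qed.

Lemma cpol_roots s : exists2 rs : seq C, cpol s = \prod_(z <- rs) ('X - z%:P) & size rs = size s.
Proof.
exists (croots (in_tuple s)); last exact: size_croots.
by rewrite -croots_prod cpoly_of_coefs_pol.
Qed.

Lemma crpol_horner s (rs : seq C) (w : C) : cpol s = \prod_(z <- rs) ('X - z%:P) ->
  size rs = size s -> w != 0 -> (crpol s).[w] = \prod_(z <- rs) (1 - z * w).
Proof.
move=> Ps rss w0; apply: (mulIf w0).
rewrite crpolE horner_Poly_rev// -cpolE Ps /= size_map -rss horner_prod.
have E l : w ^+ size l * \prod_(z <- l) ('X - z%:P).[w^-1] = \prod_(z <- l) (1 - z * w).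
  elim: l => [|z l IH]; first by rewrite !big_nil mulr1.
  rewrite !big_cons -IH /= exprS hornerXsubC.
  set p := \prod_(_ <- _) _; set q := w ^+ size l; by field.
by rewrite exprSr -mulrA (mulrC w) mulrA E.
Qed.

Lemma conj_toC (x : R) : (toC x)^* = toC x.
Proof. by apply: conj_Creal; apply/complex_realP; exists x. Qed.

Lemma normr_toC (x : R) : `|toC x| = toC `|x|.
Proof. by rewrite normc_def /= expr0n addr0 sqrtr_sqr. Qed.

Lemma conj_cpol_horner s (w : C) : ((cpol s).[w])^* = (cpol s).[w^*].
Proof.
rewrite -horner_map /=; congr horner; apply/polyP => i.
by rewrite !coef_map /= conj_toC.
Qed.

Definition stable s := forall z : C, root (cpol s) z -> `|z| <= 1.

Lemma stable_rpol_le s (w : C) : stable s -> 1 <= `|w| ->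
  `|(crpol s).[w]| <= `|(cpol s).[w]|.
Proof.
move=> st w1; have [rs Ps rss] := cpol_roots s.
have w0 : w != 0 by rewrite -normr_gt0 (lt_le_trans ltr01).
have h : {in rs, forall z, `|z| <= 1}.
  by move=> z zrs; apply: st; rewrite Ps root_prod_XsubC.
rewrite (crpol_horner Ps rss w0) -[leRHS]norm_conjC conj_cpol_horner Ps horner_prod.
rewrite !normr_prod; elim: rs h {Ps rss} => [|z rs IH] h; first by rewrite !big_nil.
rewrite !big_cons; apply: ler_pM; [by []|by apply: prodr_ge0| |]; last first.
  by apply: IH => y yrs; apply: h; rewrite inE yrs orbT.
rewrite !hornerE -(@ler_pXn2r _ 2)// ?nnegrE//.
have z1 : `|z| <= 1 by apply: h; rewrite inE eqxx.
rewrite !normCK !(rmorphB, rmorphM, rmorph1) /= conjCK -subr_ge0.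
rewrite (_ : _ - _ = (`|w| ^+ 2 - 1) * (1 - `|z| ^+ 2)); last by rewrite !normCK; ring.
by rewrite mulr_ge0// subr_ge0 ?exprn_ege1// exprn_ile1.
Qed.

Lemma stable_last s k : stable (rcons s k) -> `|k| <= 1.
Proof.
move=> st; have [rs Ps rss] := cpol_roots (rcons s k).
have : (cpol (rcons s k)).[0] = toC k.
  by rewrite horner_coef0 cpolE coef_Poly map_rcons rev_cons rev_rcons.
have h : {in rs, forall z, `|z| <= 1}.
  by move=> z zrs; apply: st; rewrite Ps root_prod_XsubC.
rewrite Ps horner_prod => e; rewrite -lecR -normr_toC -e normr_prod.
elim: rs h {Ps rss e} => [|z rs IH] h; first by rewrite big_nil.
rewrite big_cons -[leRHS]mulr1; apply: ler_pM; [by []|by apply: prodr_ge0| |].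
  by rewrite hornerXsubC sub0r normrN h// inE eqxx.
by apply: IH => y yrs; apply: h; rewrite inE yrs orbT.
Qed.

Lemma one_sub_sqr_neq0 (k : R) : `|k| < 1 -> 1 - k ^+ 2 != 0.
Proof. by move=> k1; rewrite gt_eqF// one_sub_sqr_gt0. Qed.

Lemma cpol_rcons_mix k s (w : C) :
  (cpol (rcons (mix k s) k)).[w] = w * (cpol s).[w] + toC k * (crpol s).[w].
Proof.
by rewrite /cpol pol_rcons_mix rmorphD rmorphM /= map_polyX map_polyZ !hornerE.
Qed.

Lemma crpol_rcons_mix k s (w : C) :
  (crpol (rcons (mix k s) k)).[w] = (crpol s).[w] + toC k * (w * (cpol s).[w]).
Proof.
by rewrite /crpol rpol_rcons_mix rmorphD /= map_polyZ rmorphM /= map_polyX !hornerE.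
Qed.

Lemma stable_unmix s k : stable (rcons s k) -> `|k| < 1 -> stable (unmix k s).
Proof.
move=> st k1 w /rootP Pw; rewrite real_leNgt ?normr_real ?real1//; apply/negP => w1.
have e : rcons s k = rcons (mix k (unmix k s)) k by rewrite unmixK// one_sub_sqr_neq0.
have Pa := cpol_rcons_mix k (unmix k s) w; have Pb := crpol_rcons_mix k (unmix k s) w.
rewrite -e Pw mulr0 add0r in Pa; rewrite -e Pw !mulr0 addr0 in Pb.
have := stable_rpol_le st (ltW w1); rewrite Pa Pb normrM normr_toC.
have [e0|nz] := eqVneq (crpol (unmix k s)).[w] 0.
  move=> _; have /st : root (cpol (rcons s k)) w by apply/rootP; rewrite Pa e0 mulr0.
  by move=> w1'; have := lt_le_trans w1 w1'; rewrite ltxx.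
rewrite -[leLHS]mul1r ler_pM2r ?normr_gt0// -(rmorph1 toC) lecR leNgt.
by rewrite k1.
Qed.

End Pol.

(** * Polynomials with one root outside the disk *)

Section Perron.
Context {R : realType}.
Local Notation C := R[i].
Local Notation toC := (real_complex R).
Implicit Types s b : seq R.

Lemma refl_ind (P : seq R -> seq R -> Prop) (Q : nat -> R -> Prop) :
  (forall i k, (0 < i)%N -> Q i k -> 1 - k ^+ 2 != 0) ->
  P [::] [::] ->
  (forall k b ks, size ks = size b -> P b ks -> Q (size b) k ->
     P (rcons (mix k b) k) (rcons ks k)) ->
  forall n s, size s = n ->
    (forall i, (i < n)%N -> Q i (nth 0 (refl n s) i)) -> P s (refl n s).
Proof.
move=> Qk P0 PS; elim=> [|n IH] s; first by move/size0nil => ->.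
case/lastP: s => [//|s k]; rewrite size_rcons => -[sn] HQ.
have Qn : Q n k by have := HQ n (ltnSn n); rewrite refl_rcons// nth_rcons size_refl ltnn eqxx.
have su : size (unmix k s) = n by rewrite size_unmix.
have e : rcons s k = rcons (mix k (unmix k s)) k.
  case: n {IH HQ} sn Qn su => [|n] sn Qn su; first by rewrite (size0nil sn).
  by rewrite unmixK// (Qk n.+1).
rewrite refl_rcons// {1}e; apply: PS.
- by rewrite size_refl su.
- apply: IH => // i ilt; have := HQ i (ltnW ilt).
  by rewrite refl_rcons// nth_rcons size_refl ilt.
- by rewrite su.
Qed.

(* The Christoffel-Darboux kernel. When only k_0 has modulus above 1, K is a
   constant plus a positive semidefinite kernel, whence the last condition. *)
Definition kernel_form s := exists K : C -> C -> C,
  [/\ forall z w, (crpol s).[z] * ((crpol s).[w])^* - (cpol s).[z] * ((cpol s).[w])^* =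
        (1 - z * w^*) * K z w,
      forall z w, K w z = (K z w)^* &
      forall z w, 0 <= K z z - K z w - K w z + K w w].

Lemma cpol_nil (z : C) : (cpol ([::] : seq R)).[z] = 1.
Proof. by rewrite cpolE /= /rev /= !hornerE. Qed.
Lemma crpol_nil (z : C) : (crpol ([::] : seq R)).[z] = 1.
Proof. by rewrite crpolE /= !hornerE. Qed.

Lemma kernel_form1 k : kernel_form (rcons (mix k [::]) k).
Proof.
exists (fun _ _ => toC (1 - k ^+ 2)); split.
- move=> z w; rewrite !cpol_rcons_mix !crpol_rcons_mix ?cpol_nil ?crpol_nil.
  rewrite !(rmorphD, rmorphM, rmorphN, rmorphXn, rmorph1) /= !conj_toC.
  ring.
- by move=> z w; rewrite conj_toC.
- by move=> z w; rewrite subrr sub0r addNr.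
Qed.

Lemma kernel_formS k b : `|k| < 1 -> kernel_form b -> kernel_form (rcons (mix k b) k).
Proof.
move=> k1 [K [KE KJ Kge0]].
exists (fun z w => toC (1 - k ^+ 2) * (K z w + (cpol b).[z] * ((cpol b).[w])^*)); split.
- move=> z w; rewrite !cpol_rcons_mix !crpol_rcons_mix.
  rewrite [RHS](_ : _ = toC (1 - k ^+ 2) * ((1 - z * w^*) * K z w +
      (1 - z * w^*) * ((cpol b).[z] * ((cpol b).[w])^*))); last by ring.
  rewrite -KE !(rmorphD, rmorphM, rmorphN, rmorphXn, rmorph1) /= !conj_toC.
  ring.
- move=> z w; rewrite KJ !(rmorphD, rmorphM, rmorphN, rmorphXn, rmorph1) /= !conj_toC conjCK.
  ring.
- move=> z w; set p := cpol b.
  rewrite (_ : _ + _ = toC (1 - k ^+ 2) * ((K z z - K z w - K w z + K w w) +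
     (p.[z] - p.[w]) * (p.[z] - p.[w])^*)); last by rewrite rmorphB /=; ring.
  apply: mulr_ge0; first by rewrite ler0c ltW// one_sub_sqr_gt0.
  by apply: addr_ge0; [exact: Kge0|exact: mul_conjC_ge0].
Qed.

Lemma kernel_form_root_unique s (z w : C) : kernel_form s ->
  1 < `|z| -> 1 < `|w| -> root (cpol s) z -> root (cpol s) w ->
  (crpol s).[z] != 0 -> (crpol s).[w] != 0 -> z = w.
Proof.
move=> [K [KE KJ Kge0]] z1 w1 /rootP Pz /rootP Pw d1 d2.
have A0 : 0 < `|z| ^+ 2 - 1 by rewrite subr_gt0 exprn_egt1.
have B0 : 0 < `|w| ^+ 2 - 1 by rewrite subr_gt0 exprn_egt1.
have Kzz := KE z z; have Kww := KE w w; have Kzw := KE z w.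
rewrite Pz mul0r subr0 -!normCK in Kzz.
rewrite Pw mul0r subr0 -!normCK in Kww.
rewrite Pz mul0r subr0 in Kzw.
set D1 := (crpol s).[z] in d1 Kzz Kzw; set D2 := (crpol s).[w] in d2 Kww Kzw.
have a0 : 0 < - K z z.
  rewrite -(pmulr_rgt0 _ A0) mulrN -mulNr opprB -Kzz exprn_gt0// normr_gt0//.
have b0 : 0 < - K w w.
  rewrite -(pmulr_rgt0 _ B0) mulrN -mulNr opprB -Kww exprn_gt0// normr_gt0//.
have c0 : 0 < `|K z w|.
  rewrite normr_gt0; apply/eqP => K0; move/eqP: Kzw; rewrite K0 mulr0.
  by rewrite mulf_eq0 conjC_eq0 (negbTE d1) (negbTE d2).
have ab : (- K z z) * (- K w w) <= `|K z w| ^+ 2.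
  have le1 : - K z z + - K w w <= 2 * `|K z w|.
    have := Kge0 z w; rewrite (KJ z w) => h.
    have h2 : - K z z + - K w w <= - (K z w + (K z w)^*).
      by rewrite -subr_ge0; apply: le_trans h _; rewrite le_eqVlt; apply/orP; left; apply/eqP; ring.
    apply: (le_trans h2); apply: (le_trans (real_ler_norm _)).
      by rewrite rpredN; apply/CrealP; rewrite rmorphD /= conjCK addrC.
    rewrite normrN (le_trans (ler_normD _ _))// norm_conjC mulr_natl mulr2n//.
  have le2 : (- K z z + - K w w) ^+ 2 <= (2 * `|K z w|) ^+ 2.
    by rewrite lerXn2r// ?nnegrE ?addr_ge0 ?mulr_ge0 ?ltW.
  rewrite -(@ler_pM2l _ 4)//; apply: le_trans (_ : (- K z z + - K w w) ^+ 2 <= _).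
    rewrite -subr_ge0 (_ : _ - _ = (K z z - K w w) ^+ 2); last by ring.
    rewrite real_exprn_even_ge0// rpredB//; rewrite -rpredN ger0_real// ltW//.
  by apply: le_trans le2 _; rewrite exprMn -natrX.
have zw : `|K z w| ^+ 2 * `|z - w| ^+ 2 <= 0.
  have e1 : `|1 - z * w^*| ^+ 2 = (`|z| ^+ 2 - 1) * (`|w| ^+ 2 - 1) + `|z - w| ^+ 2.
    by rewrite !normCK !(rmorphB, rmorphM, rmorph1) /= conjCK; ring.
  have e2 : `|1 - z * w^*| ^+ 2 * `|K z w| ^+ 2 =
     (`|z| ^+ 2 - 1) * (`|w| ^+ 2 - 1) * ((- K z z) * (- K w w)).
    rewrite -exprMn -normrM -Kzw normrM norm_conjC exprMn Kzz Kww; ring.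
  rewrite -(@lerD2l _ ((`|z| ^+ 2 - 1) * (`|w| ^+ 2 - 1) * `|K z w| ^+ 2)) addr0.
  rewrite [leLHS](_ : _ = `|1 - z * w^*| ^+ 2 * `|K z w| ^+ 2); last by rewrite e1; ring.
  by rewrite e2 ler_pM2l// mulr_gt0.
apply/eqP; rewrite -subr_eq0 -normr_le0.
have : `|z - w| ^+ 2 <= 0 by rewrite -(pmulr_rle0 _ (exprn_gt0 2 c0)).
by rewrite -[X in _ <= X](expr0n _ 2) ler_pXn2r ?nnegrE.
Qed.

Definition perron_refl (t : R) i (k : R) : Prop :=
  if i == 0%N then - 1 - t < k < - 1 else `|k| < 1.

Lemma pol_horner_rcons_mix k s x :
  (pol (rcons (mix k s) k)).[x] = x * (pol s).[x] + k * (rpol s).[x].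
Proof. by rewrite pol_rcons_mix !hornerE. Qed.
Lemma rpol_horner_rcons_mix k s x :
  (rpol (rcons (mix k s) k)).[x] = (rpol s).[x] + k * (x * (pol s).[x]).
Proof. by rewrite rpol_rcons_mix !hornerE. Qed.
Lemma pol_nil x : (pol ([::] : seq R)).[x] = 1.
Proof. by rewrite /pol /rev /= !hornerE. Qed.
Lemma rpol_nil x : (rpol ([::] : seq R)).[x] = 1.
Proof. by rewrite /rpol /= !hornerE. Qed.

Lemma perron_refl_pol (mu t : R) n s : 1 < mu -> t * (2 * mu) <= (mu - 1) ^+ 2 ->
  size s = n.+1 ->
  (forall i, (i < n.+1)%N -> perron_refl t i (nth 0 (refl n.+1 s) i)) ->
  [/\ (pol s).[1] < 0, 0 < (pol s).[mu], kernel_form s &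
    forall w, 1 < `|w| -> root (cpol s) w -> (crpol s).[w] != 0].
Proof.
move=> mu1 tmu sn HQ.
suff : size s = 0%N \/ [/\ (pol s).[1] < 0 /\ (rpol s).[1] = (pol s).[1], 0 < (pol s).[mu],
    `|(rpol s).[mu]| <= mu * (pol s).[mu], kernel_form s &
    forall w, 1 < `|w| -> root (cpol s) w -> (crpol s).[w] != 0].
  by rewrite sn => -[//|[[]]]; split.
pose P s (_ : seq R) := size s = 0%N \/ [/\ (pol s).[1] < 0 /\ (rpol s).[1] = (pol s).[1], 0 < (pol s).[mu],
    `|(rpol s).[mu]| <= mu * (pol s).[mu], kernel_form s &
    forall w, 1 < `|w| -> root (cpol s) w -> (crpol s).[w] != 0].
apply: (@refl_ind P (perron_refl t) _ _ _ n.+1 s sn HQ).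
- by move=> [|i] k //= _; exact: one_sub_sqr_neq0.
- by left.
move=> k b ks _ [b0|[[P1 R1] Pmu Rmu Kb Nb]] Qk; right.
  rewrite (size0nil b0) in Qk *; have /andP[k1 k2] : - 1 - t < k < - 1 := Qk; split.
  - rewrite pol_horner_rcons_mix rpol_horner_rcons_mix ?pol_nil ?rpol_nil; split; first by lra.
    by ring.
  - rewrite pol_horner_rcons_mix ?pol_nil ?rpol_nil.
    have : t <= mu - 1 by nra.
    by lra.
  - rewrite pol_horner_rcons_mix rpol_horner_rcons_mix ?pol_nil ?rpol_nil ler_norml.
    by apply/andP; split; nra.
  - exact: kernel_form1.
  - move=> w w1 /rootP; rewrite cpol_rcons_mix crpol_rcons_mix !cpol_nil ?crpol_nil !mulr1 => e.
    have {}e : toC k = - w by apply/eqP; rewrite -addr_eq0 addrC e.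
    rewrite e mulNr; apply/eqP => /eqP; rewrite subr_eq0 eq_sym => /eqP w2.
    have : `|w| ^+ 2 = 1 by rewrite -normrX expr2 w2 normr1.
    by move=> e2; have := @exprn_egt1 _ 2 _ w1; rewrite e2 ltxx.
have {}Qk : `|k| < 1
  by move: Qk; rewrite /perron_refl; case: eqP => // /size0nil b0; move: P1; rewrite b0 pol_nil ltr10.
have k2 : 0 < 1 - k ^+ 2 by exact: one_sub_sqr_gt0.
split.
- rewrite pol_horner_rcons_mix rpol_horner_rcons_mix R1; split; last by ring.
  by move: Qk; rewrite ltr_norml => /andP[? ?]; nra.
- rewrite pol_horner_rcons_mix.
  have h : `|k * (rpol b).[mu]| <= `|k| * (mu * (pol b).[mu]) by rewrite normrM ler_wpM2l.
  have h2 : `|k| * (mu * (pol b).[mu]) < mu * (pol b).[mu].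
    by rewrite gtr_pMl// mulr_gt0//; lra.
  by have := ler_norm (- (k * (rpol b).[mu])); rewrite normrN; lra.
- rewrite pol_horner_rcons_mix rpol_horner_rcons_mix.
  move: Rmu; set p := (pol b).[mu] in Pmu *; set r := (rpol b).[mu] => Rmu.
  have mp : 0 < mu * p by rewrite mulr_gt0//; lra.
  have S0 : 0 < mu * p + k * r.
    have h : `|k * r| <= `|k| * (mu * p) by rewrite normrM ler_wpM2l.
    have h2 : `|k| * (mu * p) < mu * p by rewrite gtr_pMl.
    by have := ler_norm (- (k * r)); rewrite normrN; lra.
  apply: (@le_trans _ _ (mu * p + k * r)); last by nra.
  rewrite -(@ler_pXn2r _ 2)// ?nnegrE ?(ltW S0)//.
  rewrite real_normK ?num_real// -subr_ge0.
  rewrite (_ : _ - _ = (1 - k ^+ 2) * ((mu * p) ^+ 2 - r ^+ 2)); last by ring.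
  rewrite mulr_ge0 ?(ltW k2)// subr_ge0 -(real_normK (num_real r)).
  by rewrite ler_pXn2r ?nnegrE// ltW.
- exact: kernel_formS.
- move=> w w1 /rootP; rewrite cpol_rcons_mix crpol_rcons_mix => e.
  apply/eqP => e'.
  have k2C : toC (1 - k ^+ 2) != 0 by rewrite fmorph_eq0 gt_eqF.
  have w0 : w != 0 by rewrite -normr_gt0 (lt_trans ltr01).
  have e3 : (crpol b).[w] = 0.
    apply/eqP; rewrite -(mulrI_eq0 _ (mulfI k2C)); apply/eqP.
    transitivity (((crpol b).[w] + toC k * (w * (cpol b).[w])) -
       toC k * (w * (cpol b).[w] + toC k * (crpol b).[w])).
      by rewrite rmorphB rmorph1 rmorphXn /=; ring.
    by rewrite e e' mulr0 subr0.
  have e4 : (cpol b).[w] = 0.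
    by move/eqP: e; rewrite e3 mulr0 addr0 mulf_eq0 (negbTE w0) => /eqP.
  by have := Nb w w1; rewrite e3 eqxx => /(_ _)/negP; apply => //; apply/rootP.
Qed.

Lemma coef_pol_wscale s mu i : mu != 0 ->
  (pol (wscale (fun i => mu ^- i.+1) s))`_i = mu ^- size s * (mu ^+ i * (pol s)`_i).
Proof.
move=> mu0; rewrite !coef_Poly.
have [ilt|ige] := ltnP i (size s).+1; last first.
  by rewrite !nth_default ?mulr0// size_rev //= size_wscale.
rewrite !nth_rev /= ?size_wscale// subSS.
have isz : (i <= size s)%N by [].
have -> : nth 0 (1 :: wscale (fun i : nat => mu ^- i.+1) s) (size s - i) =
   mu ^- (size s - i) * nth 0 (1 :: s) (size s - i).
  by case: (size s - i)%N => [|j] /=; rewrite ?invr1 ?mulr1// nth_wscale.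
rewrite -{3}(subnK isz) exprD invfM.
have := expf_neq0 i mu0; move: (mu ^+ i) => u u0; field; rewrite u0 expf_neq0//.
Qed.

Lemma cpol_wscale s mu x : mu != 0 ->
  (cpol (wscale (fun i => mu ^- i.+1) s)).[x] =
  toC (mu ^- size s) * (cpol s).[toC mu * x].
Proof.
move=> mu0; rewrite !(@horner_coef_wide _ (size s).+1); last 2 first.
- by rewrite size_map_poly (leq_trans (size_Poly _))// size_rev.
- by rewrite size_map_poly (leq_trans (size_Poly _))// size_rev /= size_wscale.
rewrite mulr_sumr; apply: eq_bigr => -[i ilt] _ /=.
rewrite !coef_map /= coef_pol_wscale// !rmorphM /= exprMn rmorphXn /=.
ring.
Qed.

Lemma root_cpol_wscale s mu x : mu != 0 ->
  root (cpol (wscale (fun i => mu ^- i.+1) s)) x = root (cpol s) (toC mu * x).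
Proof.
move=> mu0; rewrite /root cpol_wscale// mulf_eq0 fmorph_eq0 invr_eq0.
by rewrite expf_eq0 (negbTE mu0) andbF.
Qed.

Lemma perron_refl_OmegaP (mu t : R) n (a : n.+1.-tuple R) :
  1 < mu -> t * (2 * mu) <= (mu - 1) ^+ 2 ->
  (forall i, (i < n.+1)%N -> perron_refl t i (nth 0 (refl n.+1 a) i)) ->
  OmegaP R n.+1 [tuple of wscale (fun i => mu ^- i.+1) a].
Proof.
move=> mu1 tmu HQ.
have mu0 : 0 < mu by rewrite (lt_trans ltr01).
have mun0 : mu != 0 by rewrite gt_eqF.
have [P1 Pmu Ka Na] := perron_refl_pol mu1 tmu (size_tuple a) HQ.
have [l /andP[l1 lmu] rl] : exists2 x, 1 <= x <= mu & root (pol a) x.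
  by apply: poly_ivt; [exact: ltW|rewrite (ltW P1) (ltW Pmu)].
have {}l1 : 1 < l.
  rewrite lt_neqAle l1 andbT; apply/eqP => l1'; move/rootP: rl; rewrite -l1' => e.
  by rewrite e ltxx in P1.
have rlC : root (cpol a) (toC l) by rewrite fmorph_root.
have l1C : 1 < `|toC l|.
  by rewrite normr_toC gtr0_norm ?(lt_trans ltr01)// -(rmorph1 toC) ltcR.
have uniq w : 1 < `|w| -> root (cpol a) w -> w = toC l.
  by move=> w1 rw; apply: (kernel_form_root_unique Ka) => //; exact: Na.
have rE z : root (cpoly_of_coefs [tuple of wscale (fun i => mu ^- i.+1) a]) z =
    root (cpol a) (toC mu * z).
  by rewrite cpoly_of_coefs_pol /= root_cpol_wscale.
have muC0 : 0 < toC mu by rewrite ltcR.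
have l0 : 0 < l by rewrite (lt_trans ltr01).
have nmu z : `|toC mu * z| = toC mu * `|z|.
  by rewrite normrM normr_toC (gtr0_norm mu0).
have le_l z : root (cpol a) (toC mu * z) -> `|z| <= toC (l / mu).
  move=> rz; rewrite rmorphM fmorphV /= ler_pdivlMr// mulrC -nmu.
  rewrite real_leNgt ?normr_real//; last by apply/complex_realP; exists l.
  apply/negP => h; have e : toC mu * z = toC l.
    by apply: uniq => //; apply: lt_trans h; rewrite -(rmorph1 toC) ltcR.
  by move: h; rewrite e normr_toC (gtr0_norm l0) ltxx.
split.
  move=> z; rewrite rE => /le_l h; apply: (le_trans h).
  by rewrite -(rmorph1 toC) lecR ler_pdivrMr// mul1r.
exists (toC (l / mu)); split.
  rewrite rE; split.
    by rewrite rmorphM fmorphV /= mulrC divfK// fmorph_eq0.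
  by move=> w; rewrite rE => /le_l h; rewrite normr_toC (gtr0_norm (divr_gt0 l0 mu0)).
move=> z [rz hz]; rewrite rE in rz.
have := hz (toC (l / mu)); rewrite rE => /(_ _) h.
have : toC mu * z = toC l.
  apply: uniq => //; rewrite nmu; apply: (lt_le_trans l1C).
  rewrite mulrC -ler_pdivrMr// -(gtr0_norm muC0) -normf_div; apply: le_trans (h _).
    by rewrite rmorphM fmorphV.
  by rewrite rmorphM fmorphV /= mulrC divfK// fmorph_eq0.
by move=> e; rewrite rmorphM fmorphV /= -e mulrC mulKf// fmorph_eq0.
Qed.

End Perron.

(** * Power sums *)

Section PowerSums.
Context {R : realType}.
Local Notation C := R[i].
Local Notation toC := (real_complex R).
Implicit Types s b : seq R.

Definition eqmX (F : comNzRingType) L (p q : {poly F}) := exists r, p = q + r * 'X^L.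

Fixpoint quot_bound l : R :=
  if l is m.+1 then quot_bound m + m.+1%:R * quot_bound m ^+ 2 else 1.

Fixpoint logder_bound l : R :=
  if l is m.+1 then logder_bound m + m.+2%:R * quot_bound m.+1 +
    m.+1%:R * (quot_bound m * logder_bound m) else 1.

Lemma quot_bound_ge1 l : 1 <= quot_bound l.
Proof.
elim: l => [//|l IH] /=; apply: (le_trans IH).
by rewrite lerDl mulr_ge0// sqr_ge0.
Qed.

Lemma le_quot_bound i j : (i <= j)%N -> quot_bound i <= quot_bound j.
Proof.
move=> /subnK <-; elim: (j - i)%N => // n IH; rewrite addSn /= (le_trans IH)//.
by rewrite lerDl mulr_ge0// sqr_ge0.
Qed.

Lemma logder_bound_ge0 l : 0 <= logder_bound l.
Proof.
elim: l => //= l IH; have := quot_bound_ge1 l; have := quot_bound_ge1 l.+1 => /= h1 h2.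
by rewrite !addr_ge0// !mulr_ge0//; lra.
Qed.

Lemma le_logder_bound i j : (i <= j)%N -> logder_bound i <= logder_bound j.
Proof.
move=> /subnK <-; elim: (j - i)%N => // n IH; rewrite addSn /= (le_trans IH)//.
have := quot_bound_ge1 (n + i); have := quot_bound_ge1 (n + i).+1 => /= h1 h2.
have := logder_bound_ge0 (n + i) => h3.
by rewrite -addrA lerDl addr_ge0// !mulr_ge0//; lra.
Qed.

Lemma coef_quot L (k : R) (beta tau c v : {poly R}) :
  (1 + k *: ('X * beta)) * tau = c - v * 'X^L ->
  (0 < L)%N -> tau`_0 = c`_0 /\
  forall l, (l.+1 < L)%N ->
    tau`_l.+1 = c`_l.+1 - k * \sum_(j < l.+1) beta`_j * tau`_(l - j).
Proof.
move=> e L0.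
have E l : (l < L)%N -> tau`_l + k * ('X * (beta * tau))`_l = c`_l.
  move=> lL; have /= := congr1 (fun p : {poly R} => p`_l) e.
  by rewrite mulrDl mul1r -scalerAl -mulrA coefD coefZ coefB coefMXn lL subr0.
split; first by have := E 0%N L0; rewrite coefXM /= mulr0 addr0.
move=> l lL; have := E _ lL; rewrite coefXM /= coefM => <-.
by rewrite addrK.
Qed.

Lemma eqmX_quot (c : {poly R}) L (k : R) (beta : {poly R}) : exists tau v,
  (1 + k *: ('X * beta)) * tau = c - v * 'X^L.
Proof.
pose u : {poly R} := - (k *: ('X * beta)).
exists ((\sum_(j < L) u ^+ j) * c), ((- (k *: beta)) ^+ L * c).
have e : (1 - u) * (\sum_(j < L) u ^+ j) = 1 - u ^+ L.
  by rewrite -[RHS]opprB subrX1 -mulNr opprB.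
rewrite -[1 + _](_ : 1 - u = _); last by rewrite opprK.
rewrite mulrA e mulrBl mul1r; congr (_ - _).
rewrite mulrAC -exprMn mulNr -scalerAl mulrC (mulrC beta) /u.
by rewrite mulrC.
Qed.

(* [beta] expands pol/rpol, and [sigma] expands -rpol'/rpol, whose coefficients
   are the power sums of the roots. Appending k multiplies rpol by 1 + k X beta,
   so it changes [sigma] by O(|k|). *)
Definition refl_series L s (ks : seq R) := exists beta sigma : {poly R},
  [/\ eqmX L (pol s) (beta * rpol s),
      eqmX L (rpol s)^`() (- sigma * rpol s),
      forall l, (l < L)%N -> `|beta`_l| <= quot_bound l &
      forall l, (l < L)%N -> `|sigma`_l| <= logder_bound L * \sum_(k <- ks) `|k|].

Lemma refl_series_ind L n s : size s = n -> (0 < L)%N ->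
  (forall i, (i < n)%N -> `|nth 0 (refl n s) i| < 1) -> refl_series L s (refl n s).
Proof.
move=> sn L0 HQ; apply: (@refl_ind _ (refl_series L) (fun _ k => `|k| < 1) _ _ _ n s sn HQ).
- by move=> i k _; exact: one_sub_sqr_neq0.
- exists 1, 0; split.
  + by exists 0; rewrite mul1r mul0r addr0 /pol /rpol /rev /=.
  + by exists 0; rewrite mul0r addr0 oppr0 mul0r /rpol /= cons_poly_def mul0r add0r derivC.
  + move=> l _; rewrite coef1; have := quot_bound_ge1 l; case: eqP => _ /=; rewrite ?normr1 ?normr0//; lra.
  + by move=> l _; rewrite coef0 normr0 big_nil mulr0.
move=> k b ks _ [beta [sigma [[r1 e1] [r2 e2] Hb Hs]]] k1.
have k1' := ltW k1.
have [beta' [v1 f1]] := eqmX_quot ('X * beta + k%:P) L k beta.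
have [tau [v2 f2]] := eqmX_quot (k *: ('X * beta)^`()) L k beta.
exists beta', (sigma - tau); rewrite pol_rcons_mix rpol_rcons_mix.
have [g10 g1] := coef_quot f1 L0; have [g20 g2] := coef_quot f2 L0.
have kb (x : R) : `|k * x| <= `|x| by rewrite normrM ler_piMl.
have Hb' l : (l < L)%N -> `|beta'`_l| <= quot_bound l.
  elim/ltn_ind: l => -[|l] IH lL.
    by rewrite g10 coefD coefXM /= coefC eqxx add0r.
  rewrite g1// coefD coefXM /= coefC /= addr0.
  apply: (le_trans (ler_normB _ _)); apply: lerD; first by apply: Hb; exact: ltnW.
  apply: (le_trans (kb _)); apply: (le_trans (ler_norm_sum _ _ _)).
  rewrite mulr_natl -[X in _ *+ X](card_ord l.+1) -sumr_const; apply: ler_sum => -[j jl] _ /=.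
  rewrite normrM expr2 ler_pM//.
    by apply: (le_trans (Hb _ _)); [lia|apply: le_quot_bound].
  by apply: (le_trans (IH _ _ _)); [lia|lia|apply: le_quot_bound; lia].
have Ht l : (l < L)%N -> `|tau`_l| <= `|k| * logder_bound l.
  elim/ltn_ind: l => -[|l] IH lL.
    rewrite g20 coefZ coef_deriv coefXM /= mulr1n normrM ler_wpM2l//.
    exact: Hb.
  have h1 : `|beta`_l.+1 *+ l.+2| <= l.+2%:R * quot_bound l.+1.
    rewrite normrMn -[leLHS]mulr_natl. apply: ler_wpM2l; [exact: ler0n|exact: (Hb l.+1 lL)].
  have h2 : `|\sum_(j < l.+1) beta`_j * tau`_(l - j)| <=
      l.+1%:R * (quot_bound l * logder_bound l).
    apply: (le_trans (ler_norm_sum _ _ _)).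
    rewrite mulr_natl -[X in _ *+ X](card_ord l.+1) -sumr_const; apply: ler_sum => -[j jl] _ /=.
    rewrite normrM ler_pM//.
      by apply: (le_trans (Hb _ _)); [lia|apply: le_quot_bound].
    apply: (le_trans (IH _ _ _)); [lia|lia|].
    apply: (@le_trans _ _ (logder_bound (l - j))); last by apply: le_logder_bound; lia.
    by rewrite ler_piMl// logder_bound_ge0.
  rewrite g2// coefZ coef_deriv coefXM [_ == 0%N]/= -mulrBr normrM ler_wpM2l//.
  apply: (le_trans (ler_normB _ _)); apply: (le_trans (lerD h1 h2)).
  by rewrite -[leRHS]/(_ + _ + _) lerD2r lerDr logder_bound_ge0.
split.
- exists ('X * r1 + v1 * rpol b - beta' * (k *: ('X * r1))).
  transitivity (('X * beta + k%:P) * rpol b + 'X * r1 * 'X^L).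
    by rewrite e1 -mul_polyC; ring.
  rewrite (_ : 'X * beta + k%:P = (1 + k *: ('X * beta)) * beta' + v1 * 'X^L); last first.
    by rewrite f1 addrNK.
  by rewrite e1 -!mul_polyC; ring.
- set A := 1 + k *: ('X * beta) in f1 f2.
  have eA : rpol b + k *: ('X * pol b) = A * rpol b + k *: ('X * r1) * 'X^L.
    by rewrite e1 /A -!mul_polyC; ring.
  have dA : A^`() = tau * A + v2 * 'X^L.
    by rewrite mulrC f2 addrNK /A derivD derivC add0r derivZ.
  pose w := (k *: ('X * r1))^`() + k *: r1 *+ L.
  have ew : (k *: ('X * r1) * 'X^L)^`() = w * 'X^L.
    rewrite derivM derivXn /w mulrDl; congr (_ + _).
    have eX : ('X^L : {poly R}) = 'X * 'X^(L.-1) by rewrite -exprS prednK.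
    rewrite [X in _ = _ * X]eX mulrnAr mulrnAl -!mul_polyC; congr (_ *+ _).
    by move: ('X^(L.-1) : {poly R}) => Y; ring.
  exists (v2 * rpol b + A * r2 + w - (tau - sigma) * (k *: ('X * r1))).
  rewrite eA derivD derivM ew e2 dA; clearbody A w.
  move: (k *: ('X * r1)) (rpol b) ('X^L : {poly R}) => u p X; ring.
- exact: Hb'.
- move=> l lL; rewrite coefB; apply: (le_trans (ler_normB _ _)).
  have h1 := Hs l lL; have h2 := Ht l lL.
  have h3 := ler_wpM2l (normr_ge0 k) (le_logder_bound (ltnW lL)).
  rewrite -cats1 big_cat big_seq1 /= mulrDr (mulrC (logder_bound L) `|k|).
  by lra.
Qed.

Lemma poly_eq_nonzero (F : numFieldType) (p q : {poly F}) :
  (forall w, w != 0 -> p.[w] = q.[w]) -> p = q.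
Proof.
move=> H; apply/eqP; rewrite -subr_eq0; apply/eqP.
apply: (@roots_geq_poly_eq0 _ _ [seq i.+1%:R | i <- iota 0 (size (p - q))]).
- apply/allP => x /mapP[i _ ->]; apply/rootP.
  by rewrite hornerD hornerN H ?subrr// pnatr_eq0.
- rewrite map_inj_uniq ?iota_uniq// => i j /eqP.
  by rewrite eqr_nat eqSS => /eqP.
- by rewrite size_map size_iota.
Qed.

Lemma crpol_prod s (rs : seq C) : cpol s = \prod_(z <- rs) ('X - z%:P) ->
  size rs = size s -> crpol s = \prod_(z <- rs) (1 - z *: 'X).
Proof.
move=> Ps rss; apply: poly_eq_nonzero => w w0; rewrite (crpol_horner Ps rss w0).
by rewrite horner_prod; apply: eq_bigr => z _; rewrite !hornerE.
Qed.

Definition power_sum (rs : seq C) m : C := \sum_(z <- rs) z ^+ m.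

Lemma deriv_prod_reversed L (rs : seq C) :
  eqmX L (\prod_(z <- rs) (1 - z *: 'X))^`()
    (- (\poly_(m < L) power_sum rs m.+1) * \prod_(z <- rs) (1 - z *: 'X)).
Proof.
elim: rs => [|z rs [r IH]].
  exists 0; rewrite !big_nil derivC (_ : \poly_(m < L) _ = 0); first by rewrite oppr0 mul0r add0r mul0r.
  by apply/polyP => i; rewrite coef_poly /power_sum big_nil coef0 if_same.
pose G : {poly C} := z *: \sum_(i < L) (z *: 'X) ^+ i.
have eG : (1 - z *: 'X) * G = z *: (1 - (z *: 'X) ^+ L).
  by rewrite /G -scalerAr -[in RHS]opprB subrX1 -mulNr opprB.
have -> : \poly_(m < L) power_sum (z :: rs) m.+1 = G + \poly_(m < L) power_sum rs m.+1.
  apply/polyP => i; rewrite coefD !coef_poly /G coefZ coef_sum.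
  case: ltnP => iL; last first.
    rewrite big1 ?mulr0 ?addr0// => j _; rewrite exprZn coefZ coefXn.
    by rewrite (_ : (i == j) = false) ?mulr0//; apply/eqP; have := ltn_ord j; lia.
  rewrite /power_sum big_cons; congr (_ + _).
  rewrite (bigD1 (Ordinal iL))//= exprZn coefZ coefXn eqxx mulr1 big1 ?addr0 ?exprS// => j.
  rewrite -val_eqE /= => ji; rewrite exprZn coefZ coefXn.
  by rewrite eq_sym (negbTE ji) mulr0.
rewrite !big_cons derivM IH.
have -> : (1 - z *: 'X)^`() = - z%:P.
  by rewrite derivB derivC derivZ derivX sub0r alg_polyC.
move: (\prod_(j <- rs) _) (\poly_(m < L) _) => q S.
exists ((1 - z *: 'X) * r - z ^+ L.+1 *: q).
have key : G * ((1 - z *: 'X) * q) = z *: (1 - (z *: 'X) ^+ L) * q.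
  by rewrite mulrA (mulrC G) eG.
rewrite [X in _ = X + _](_ : _ = - (z *: (1 - (z *: 'X) ^+ L) * q) - S * ((1 - z *: 'X) * q)); last first.
  by rewrite -key; clear; clearbody G; ring.
rewrite exprZn.
rewrite -!mul_polyC exprS polyCM; ring.
Qed.

Lemma eqmX_cancel (F : fieldType) L (p s t : {poly F}) : p.[0] != 0 ->
  eqmX L (s * p) (t * p) -> forall l, (l < L)%N -> s`_l = t`_l.
Proof.
move=> p0 [r e] l lL.
have : 'X^L %| (s - t) * p by rewrite mulrBl e addrAC subrr add0r dvdp_mull.
rewrite Gauss_dvdpl; last first.
  by rewrite coprimep_sym; apply: coprimep_expr; rewrite coprimepX /root.
move=> /dvdpP[q eq]; apply/eqP; rewrite -subr_eq0 -coefB eq coefMXn lL.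
by [].
Qed.

Lemma power_sum_le L n s (rs : seq C) m : size s = n -> (m < L)%N ->
  cpol s = \prod_(z <- rs) ('X - z%:P) -> size rs = size s ->
  (forall i, (i < n)%N -> `|nth 0 (refl n s) i| < 1) ->
  `|power_sum rs m.+1| <= toC (logder_bound L * \sum_(k <- refl n s) `|k|).
Proof.
move=> sn mL Ps rss HQ; have L0 : (0 < L)%N by apply: leq_ltn_trans mL.
have [beta [sigma [_ [r e] _ Hs]]] := refl_series_ind sn L0 HQ.
have [r' e'] := deriv_prod_reversed L rs; rewrite -(crpol_prod Ps rss) in e'.
have : power_sum rs m.+1 = toC sigma`_m.
  have := @eqmX_cancel _ L (crpol s) (\poly_(i < L) power_sum rs i.+1) (map_poly toC sigma).
  move=> /(_ _ _ m mL); rewrite coef_poly mL coef_map; apply.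
    by rewrite horner_coef0 coef_map /= coef_Poly /= oner_eq0.
  have := congr1 (map_poly toC) e; rewrite rmorphD !rmorphM rmorphN /= map_polyXn.
  rewrite -deriv_map -/(crpol s) e' => e2.
  exists (r' - map_poly toC r); rewrite mulrBl.
  move: e2; rewrite !mulNr => e2.
  set S := \poly_(_ < _) _ in e2 *; transitivity (r' * 'X^L - (- (S * crpol s) + r' * 'X^L)).
    by clearbody S; ring.
  by rewrite e2; ring.
by move=> ->; rewrite normr_toC lecR Hs.
Qed.

End PowerSums.

(** * Weyl equidistribution with the Fejer kernel *)

Section Fejer.
Context {R : realType}.
Local Notation C := R[i].
Local Notation toC := (real_complex R).

Definition nrm (z : C) : R := complex.Re `|z|.

Lemma nrmE z : `|z| = toC (nrm z).
Proof. by rewrite /nrm RRe_real// normr_real. Qed.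

Lemma nrm_ge0 z : 0 <= nrm z.
Proof. by rewrite -ler0c -nrmE normr_ge0. Qed.

Lemma sumr_const_seq (V : nmodType) (T : Type) (s : seq T) (x : V) :
  \sum_(i <- s) x = x *+ size s.
Proof. by rewrite big_const_seq count_predT iter_addr addr0. Qed.

Lemma nrm_le z x : (nrm z <= x) = (`|z| <= toC x).
Proof. by rewrite nrmE lecR. Qed.

Definition fejer n (u : C) : R := nrm (\sum_(l < n) u ^+ l) ^+ 2 / n%:R.

Lemma fejer_ge0 n u : 0 <= fejer n u.
Proof. by rewrite divr_ge0// sqr_ge0. Qed.

Lemma fejer_tail n u tau : `|u| = 1 -> 0 < tau -> tau <= nrm (u - 1) ->
  fejer n u <= 4 / (n%:R * tau ^+ 2).
Proof.
move=> u1 tau0 h.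
have e : nrm (u - 1) * nrm (\sum_(l < n) u ^+ l) <= 2.
  rewrite -lecR rmorphM /= -!nrmE -normrM -subrX1 (le_trans (ler_normB _ _))//.
  by rewrite normrX u1 expr1n normr1 rmorphD rmorph1.
have := nrm_ge0 (\sum_(l < n) u ^+ l); rewrite /fejer.
move: (nrm (\sum_(l < n) u ^+ l)) e => T e T0.
have tS : tau * T <= 2 by apply: le_trans e; apply: ler_wpM2r.
case: n => [|n]; first by rewrite mul0r invr0 !mulr0.
rewrite invfM mulrA [leRHS]mulrAC ler_wpM2r//.
rewrite ler_pdivlMr ?exprn_gt0// -exprMn mulrC.
have : (tau * T) ^+ 2 <= 2 ^+ 2.
  by rewrite lerXn2r// ?nnegrE// mulr_ge0// (ltW tau0).
by rewrite -natrX.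
Qed.

Lemma unit_pow_conj (u : C) a b : `|u| = 1 -> (b <= a)%N -> u ^+ a * (u ^+ b)^* = u ^+ (a - b).
Proof.
move=> u1 ba; rewrite -{1}(subnK ba) exprD -mulrA -normCK normrX u1 !expr1n mulr1.
by [].
Qed.

Lemma fejer_sum n (us : seq C) (B : R) : (0 < n)%N -> 0 <= B ->
  (forall u, u \in us -> `|u| = 1) ->
  (forall m, (0 < m < n)%N -> `|\sum_(u <- us) u ^+ m| <= toC B) ->
  `|\sum_(u <- us) fejer n u - (size us)%:R| <= n%:R * B.
Proof.
move=> n0 B0 us1 usB.
have e1 u : toC (n%:R * fejer n u) = \sum_(a < n) \sum_(b < n) u ^+ a * (u ^+ b)^*.
  rewrite /fejer mulrC divfK ?pnatr_eq0 -?lt0n// rmorphXn /= -nrmE normCK rmorph_sum /=.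
  by rewrite mulr_suml; apply: eq_bigr => a _; rewrite mulr_sumr.
pose G (a b : 'I_n) := \sum_(u <- us) u ^+ a * (u ^+ b)^*.
have eS : toC (n%:R * \sum_(u <- us) fejer n u) = \sum_(a < n) \sum_(b < n) G a b.
  rewrite mulr_sumr rmorph_sum /= (eq_bigr _ (fun u _ => e1 u)).
  by rewrite exchange_big /=; apply: eq_bigr => a _; rewrite exchange_big.
have eD : toC (n%:R * (size us)%:R) = \sum_(a < n) \sum_(b < n) (if a == b then (size us)%:R else 0).
  have h (a : 'I_n) : \sum_(b < n) (if a == b then (size us)%:R else 0 : C) = (size us)%:R.
    by rewrite -big_mkcond (big_pred1 a)// => b; rewrite /= eq_sym.
  rewrite (eq_bigr _ (fun a _ => h a)).
  by rewrite sumr_const card_ord -[RHS]mulr_natl rmorphM /= !rmorph_nat.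
have GB (a b : 'I_n) : `|G a b - (if a == b then (size us)%:R else 0)| <= toC B.
  case: (ltngtP a b) => ab.
  - rewrite -val_eqE /= (ltn_eqF ab) subr0 -norm_conjC rmorph_sum /=.
    rewrite big_seq (eq_bigr (fun u => u ^+ (b - a))) => [|u uus].
      by rewrite -big_seq; apply: usB; have := ltn_ord b; lia.
    by rewrite rmorphM /= conjCK mulrC unit_pow_conj ?us1// ltnW.
  - rewrite -val_eqE /= (gtn_eqF ab) subr0.
    rewrite /G big_seq (eq_bigr (fun u => u ^+ (a - b))) => [|u uus].
      by rewrite -big_seq; apply: usB; have := ltn_ord a; lia.
    by rewrite unit_pow_conj ?us1// ltnW.
  - rewrite (val_inj ab) eqxx /G big_seq (eq_bigr (fun=> 1)) => [|u uus].
      by rewrite -big_seq sumr_const_seq subrr normr0 ler0c.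
    by rewrite unit_pow_conj ?us1// subnn.
have n0' : 0 < n%:R :> R by rewrite ltr0n.
rewrite -(ler_pM2l n0') -{1}(gtr0_norm n0') -normrM mulrBr -lecR -normr_toC.
rewrite rmorphB /= eS eD -sumrB.
apply: (le_trans (ler_norm_sum _ _ _)).
apply: (@le_trans _ _ (\sum_(a < n) \sum_(b < n) toC B)).
  apply: ler_sum => a _; rewrite -sumrB; apply: (le_trans (ler_norm_sum _ _ _)).
  by apply: ler_sum => b _; exact: GB.
by rewrite !sumr_const !card_ord !rmorphM /= !rmorph_nat !mulr_natl.
Qed.

Lemma weyl_fejer (F : C -> R) (M eps tau B : R) n (ws zs : seq C) :
  (0 < n)%N -> (0 < size ws)%N -> (0 < size zs)%N ->
  (forall z, `|F z| <= M) -> 0 < tau -> 0 <= B ->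
  (forall u v, `|u| = 1 -> `|v| = 1 -> nrm (u - v) < tau -> `|F u - F v| <= eps) ->
  (forall w, w \in ws -> `|w| = 1) -> (forall z, z \in zs -> `|z| = 1) ->
  (forall m, (0 < m < n)%N -> \sum_(z <- zs) z ^+ m = 0) ->
  (forall m, (0 < m < n)%N -> `|\sum_(w <- ws) w ^+ m| <= toC (B * (size ws)%:R)) ->
  `|(size ws)%:R^-1 * \sum_(w <- ws) F w - (size zs)%:R^-1 * \sum_(z <- zs) F z| <=
    eps + 2 * M * (4 / (n%:R * tau ^+ 2)) + M * (n%:R * B).
Proof.
move=> n0 ws0 zs0 FM tau0 B0 Fu ws1 zs1 zsm wsm.
have M0 : 0 <= M by apply: le_trans (FM 0).
set N := (size ws)%:R; set L := (size zs)%:R.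
have N0 : 0 < N :> R by rewrite ltr0n.
have L0 : 0 < L :> R by rewrite ltr0n.
have unitM z w : `|z| = 1 -> `|w| = 1 -> `|w * z^*| = 1.
  by move=> z1 w1; rewrite normrM norm_conjC z1 w1 mulr1.
pose K w z := fejer n (w * z^*).
have K0 w z : 0 <= K w z by exact: fejer_ge0.
have Kz w : w \in ws -> \sum_(z <- zs) K w z = L.
  move=> wws; apply/eqP; rewrite -subr_eq0 -normr_le0.
  have -> : \sum_(z <- zs) K w z = \sum_(u <- [seq w * z^* | z <- zs]) fejer n u by rewrite big_map.
  rewrite /L -(size_map (fun z => w * z^*)) -[leRHS](mulr0 n%:R).
  apply: fejer_sum => // [u /mapP[z zzs ->]|m mn]; first by apply: unitM; [exact: zs1|exact: ws1].
  rewrite big_map (eq_bigr (fun z => w ^+ m * (z ^+ m)^*)); last first.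
    by move=> z _; rewrite exprMn rmorphXn /=.
  by rewrite -mulr_sumr -rmorph_sum /= zsm// rmorph0 mulr0 normr0.
have Kw z : z \in zs -> `|\sum_(w <- ws) K w z - N| <= n%:R * (B * N).
  move=> zzs.
  have -> : \sum_(w <- ws) K w z = \sum_(u <- [seq w * z^* | w <- ws]) fejer n u by rewrite big_map.
  rewrite /N -(size_map (fun w => w * z^*)).
  apply: fejer_sum => // [|u /mapP[w wws ->]|m mn].
  - by rewrite mulr_ge0.
  - by apply: unitM; [exact: zs1|exact: ws1].
  rewrite big_map (eq_bigr (fun w => w ^+ m * (z ^+ m)^*)); last first.
    by move=> w _; rewrite exprMn rmorphXn /=.
  rewrite -mulr_suml normrM norm_conjC normrX (zs1 z zzs) expr1n mulr1 size_map.
  exact: wsm.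
pose S := \sum_(w <- ws) \sum_(z <- zs) F z * K w z.
pose T := 4 / (n%:R * tau ^+ 2).
have T0 : 0 <= T by rewrite divr_ge0// mulr_ge0// sqr_ge0.
have b1 : `|L * \sum_(w <- ws) F w - S| <= N * L * (eps + 2 * M * T).
  rewrite mulr_sumr /S -sumrB; apply: (le_trans (ler_norm_sum _ _ _)).
  apply: (@le_trans _ _ (\sum_(w <- ws) L * (eps + 2 * M * T))); last first.
    by rewrite sumr_const_seq -[leLHS]mulr_natl mulrA.
  rewrite big_seq [leRHS]big_seq; apply: ler_sum => w wws.
  rewrite -{1}(Kz w wws) mulr_suml -sumrB; apply: (le_trans (ler_norm_sum _ _ _)).
  apply: (@le_trans _ _ (\sum_(z <- zs) (K w z * eps + 2 * M * T))); last first.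
    by rewrite big_split /= -mulr_suml Kz// sumr_const_seq mulrDr lerD// -[leLHS]mulr_natl.
  rewrite big_seq [leRHS]big_seq; apply: ler_sum => z zzs.
  rewrite (mulrC (F z)) -mulrBr normrM ger0_norm//.
  have eps0 : 0 <= eps.
    by apply: le_trans (Fu w w _ _ _); rewrite ?ws1// subrr /nrm normr0.
  have [far|near] := leP tau (nrm (w - z)).
    have kt : K w z <= T.
      apply: fejer_tail => //; first by apply: unitM; [exact: zs1|exact: ws1].
      have e3 : nrm (w * z^* - 1) = nrm (w - z).
        apply: (@complexI R); rewrite -!nrmE -[RHS]mulr1 -[in RHS](zs1 z zzs).
        by rewrite -(norm_conjC z) -normrM mulrBl -normCK (zs1 z zzs) expr1n.
      by rewrite e3.
    have fm : `|F w - F z| <= 2 * M.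
      by rewrite mulr_natl mulr2n (le_trans (ler_normB _ _))// lerD.
    have h1 : K w z * `|F w - F z| <= T * (2 * M) by apply: ler_pM.
    have h2 : 0 <= K w z * eps by rewrite mulr_ge0.
    by lra.
  have h1 : K w z * `|F w - F z| <= K w z * eps.
    by apply: ler_wpM2l => //; apply: Fu => //; [exact: ws1|exact: zs1].
  have h2 : 0 <= M * T by rewrite mulr_ge0.
  by lra.
have b2 : `|S - N * \sum_(z <- zs) F z| <= N * L * (M * (n%:R * B)).
  rewrite mulr_sumr /S exchange_big /= -sumrB; apply: (le_trans (ler_norm_sum _ _ _)).
  apply: (@le_trans _ _ (\sum_(z <- zs) N * (M * (n%:R * B)))); last first.
    by rewrite sumr_const_seq -[leLHS]mulr_natr mulrAC.
  rewrite big_seq [leRHS]big_seq; apply: ler_sum => z zzs.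
  rewrite -mulr_sumr (mulrC N) -mulrBr normrM.
  rewrite (_ : N * _ = M * (n%:R * (B * N))); last by ring.
  by apply: ler_pM => //; exact: Kw.
have NL : 0 < N * L by rewrite mulr_gt0.
rewrite -(ler_pM2l NL) -{1}(gtr0_norm NL) -normrM mulrBr.
rewrite (_ : N * L * (N^-1 * _) = L * \sum_(w <- ws) F w); last by field; rewrite gt_eqF.
rewrite (_ : N * L * (L^-1 * _) = N * \sum_(z <- zs) F z); last by field; rewrite gt_eqF.
rewrite (_ : _ - _ = (L * \sum_(w <- ws) F w - S) + (S - N * \sum_(z <- zs) F z)); last by ring.
by rewrite (le_trans (ler_normD _ _))// mulrDr lerD.
Qed.

End Fejer.

(** * The unit circle *)

Section Circle.
Context {R : realType}.
Local Notation C := R[i].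
Local Notation toC := (real_complex R).

Definition cis (t : R) : C := (cos t +i* sin t)%C.

Lemma nrm_sqr (z : C) : nrm z ^+ 2 = complex.Re z ^+ 2 + complex.Im z ^+ 2.
Proof.
by rewrite /nrm normc_def /= sqr_sqrtr// addr_ge0// sqr_ge0.
Qed.

Lemma nrmD (z w : C) : nrm (z + w) <= nrm z + nrm w.
Proof. by rewrite nrm_le rmorphD /= -!nrmE ler_normD. Qed.

Lemma nrmM (z w : C) : nrm (z * w) = nrm z * nrm w.
Proof. by apply: (@complexI R); rewrite rmorphM /= -!nrmE normrM. Qed.

Lemma norm_cis t : `|cis t| = 1.
Proof. by rewrite normc_def /= cos2Dsin2 sqrtr1. Qed.

Lemma cisD a b : cis (a + b) = cis a * cis b.
Proof.
apply/eqP; rewrite eq_complex /cis sinD cosD /=.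
by apply/andP; split; apply/eqP; ring.
Qed.

Lemma cis_natM a n : cis (n%:R * a) = cis a ^+ n.
Proof.
elim: n => [|n IH]; first by rewrite mul0r expr0 /cis cos0 sin0.
by rewrite -natr1 mulrDl mul1r cisD IH exprSr.
Qed.

Lemma cis2pi : cis (2 * pi) = 1.
Proof. by rewrite /cis mulr_natl cos2pi sin2pi. Qed.

Lemma cis_surj (w : C) : `|w| = 1 -> exists2 t : R, 0 <= t <= 2 * pi & w = cis t.
Proof.
move=> w1; have e : complex.Re w ^+ 2 + complex.Im w ^+ 2 = 1.
  by rewrite -nrm_sqr /nrm w1 /= expr1n.
have x1 : - 1 <= complex.Re w <= 1 by apply/andP; split; nra.
have := acos_ge0 x1; have := acos_lepi x1; have := acosK x1; have := sin_acos x1.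
set t := acos _ => s c tp t0.
have es : sin t = `|complex.Im w| by rewrite s -sqrtr_sqr; congr Num.sqrt; lra.
have pi0 := pi_ge0 R.
have [im0|im0] := leP 0 (complex.Im w).
  exists t; first by lra.
  by rewrite /cis es c ger0_norm//; case: (w).
exists (2 * pi - t); first by lra.
rewrite /cis cosB sinB mulr_natl cos2pi sin2pi es c ltr0_norm//.
by rewrite !mul1r !mul0r addr0 sub0r opprK; case: (w).
Qed.

Lemma nrm_cisB a b : nrm (cis a - cis b) ^+ 2 = 2 - 2 * cos (a - b).
Proof.
rewrite nrm_sqr /= cosB.
have := cos2Dsin2 a; have := cos2Dsin2 b; nra.
Qed.

Lemma cis_close (r : R) : 0 < r ->
  exists2 d : R, 0 < d & forall a b, `|a - b| < d -> nrm (cis a - cis b) < r.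
Proof.
move=> r0.
have /cvgrPdist_lt/(_ (r ^+ 2 / 2)) := @continuous_cos R 0.
move=> /(_ _)[|d /= d0 Hd]; first by rewrite divr_gt0// exprn_gt0.
exists d => // a b ab; have := Hd (a - b); rewrite /= sub0r normrN cos0 => /(_ ab) h.
rewrite -(@ltr_pXn2r _ 2)// ?nnegrE ?nrm_ge0 ?(ltW r0)// nrm_cisB.
by have := ler_norm (1 - cos (a - b)); lra.
Qed.

Lemma continuous_nrm (f : C -> R) (eps : R) (z : C) :
  continuous (f : C^o -> R) -> 0 < eps ->
  exists2 r : R, 0 < r & forall w, nrm (w - z) < r -> `|f w - f z| < eps.
Proof.
move=> cf eps0; have /cvgrPdist_lt/(_ _ eps0) := cf z.
move=> /nbhs_ballP[e /= e0 He].
have er : e = toC (complex.Re e) by rewrite RRe_real// gtr0_real.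
have re0 : 0 < complex.Re e by rewrite -ltcR -er.
exists (complex.Re e) => // w wz; rewrite distrC; apply: He.
by rewrite -ball_normE /ball_ /= distrC er nrmE ltcR.
Qed.

Lemma unif_continuous_circle (f : C -> R) (eps : R) :
  continuous (f : C^o -> R) -> 0 < eps ->
  exists2 tau : R, 0 < tau &
    forall z w, `|w| = 1 -> nrm (z - w) < tau -> `|f z - f w| <= eps.
Proof.
move=> cf eps0.
pose P (i t : R) := forall z, nrm (z - cis t) < i -> `|f z - f (cis t)| <= eps.
have /compact_near_coveringP/(_ R (at_right 0) P _) := @segment_compact R 0 (2 * pi).
case.
  move=> t _; have eps20 : 0 < eps / 2 by rewrite divr_gt0.
  have [r r0 Hr] := continuous_nrm (cis t) cf eps20.
  have r20 : 0 < r / 2 by rewrite divr_gt0.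
  have [d d0 Hd] := cis_close r20.
  near=> t' i; rewrite /P /= => z zi.
  have tt' : nrm (cis t' - cis t) < r / 2.
    by apply: Hd; rewrite distrC; near: t'; exact: (@nbhsx_ballx _ _ t d d0).
  have ir : i < r / 2 by near: i; exact: nbhs_right_lt.
  have h1 : `|f z - f (cis t)| < eps / 2.
    apply: Hr; rewrite (_ : z - cis t = (z - cis t') + (cis t' - cis t)); last by ring.
    by apply: le_lt_trans (nrmD _ _) _; lra.
  have h2 : `|f (cis t') - f (cis t)| < eps / 2 by apply: Hr; lra.
  rewrite (_ : f z - f (cis t') = (f z - f (cis t)) - (f (cis t') - f (cis t))); last by ring.
  by apply: (le_trans (ler_normB _ _)); lra.
move=> tau /= tau0 Htau.
exists (tau / 2); first by rewrite divr_gt0.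
move=> z w w1 zw; have [t t02 wt] := cis_surj w1.
rewrite wt in zw *; apply: (Htau (tau / 2)) => //=.
- by rewrite sub0r normrN gtr0_norm ?divr_gt0//; lra.
- by rewrite divr_gt0.
Unshelve. all: by end_near. Qed.

Definition unit_roots L : seq C := [seq cis (2 * pi / L%:R) ^+ j | j <- iota 0 L].

Lemma size_unit_roots L : size (unit_roots L) = L.
Proof. by rewrite size_map size_iota. Qed.

Lemma norm_unit_roots L z : z \in unit_roots L -> `|z| = 1.
Proof. by move=> /mapP[j _ ->]; rewrite normrX norm_cis expr1n. Qed.

Lemma cis_neq1 t : 0 < t < 2 * pi -> cis t != 1.
Proof.
move=> /andP[t0 t2]; rewrite eq_complex negb_and /=; apply/orP; left.
rewrite lt_eqF// (_ : t = (t / 2) *+ 2); last by rewrite -mulr_natr divfK.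
have s0 : 0 < sin (t / 2).
  by apply: sin_gt0_pi; rewrite divr_gt0//= ltr_pdivrMr// mulrC.
rewrite cos_mulr2n; have := cos2Dsin2 (t / 2); nra.
Qed.

Lemma sum_unit_roots L m : (0 < m < L)%N -> \sum_(z <- unit_roots L) z ^+ m = 0.
Proof.
move=> /andP[m0 mL]; set w := cis (2 * pi / L%:R).
have L0 : 0 < L%:R :> R by rewrite ltr0n; lia.
have wm : w ^+ m != 1.
  rewrite -cis_natM; apply: cis_neq1; have pi0 := pi_gt0 R.
  have q0 : 0 < m%:R / L%:R :> R by rewrite divr_gt0// ltr0n.
  have q1 : m%:R / L%:R < 1 :> R by rewrite ltr_pdivrMr// mul1r ltr_nat.
  rewrite (_ : _ * _ = 2 * pi * (m%:R / L%:R)); last by ring.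
  by apply/andP; split; nra.
have e : (w ^+ m - 1) * \sum_(z <- unit_roots L) z ^+ m = 0.
  rewrite big_map (_ : iota 0 L = index_iota 0 L) ?big_mkord; last by rewrite /index_iota subn0.
  rewrite (eq_bigr (fun i : 'I_L => (w ^+ m) ^+ i)) -?subrX1; last first.
    by move=> i _; rewrite exprAC.
  rewrite exprAC -cis_natM (_ : _ * _ = 2 * pi) ?cis2pi ?expr1n ?subrr//.
  by field; rewrite gt_eqF.
by apply/eqP; move/eqP: e; rewrite mulf_eq0 subr_eq0 (negbTE wm).
Qed.

End Circle.

(** * Riemann sums over roots of unity *)

Section Riemann.
Context {R : realType}.
Local Notation C := R[i].
Local Notation leb := (@lebesgue_measure R).

Lemma continuous_itv_integrable (g : R -> R) (a b : R) : continuous g ->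
  leb.-integrable `[a, b] (EFin \o g).
Proof.
move=> cg; apply: continuous_compact_integrable; first exact: segment_compact.
exact: continuous_subspaceT.
Qed.

Lemma Rintegral_near_cst (g : R -> R) (a b c eps : R) : continuous g -> a <= b ->
  (forall t, a < t <= b -> `|g t - c| <= eps) ->
  `|\int[leb]_(t in `]a, b]) g t - c * (b - a)| <= eps * (b - a).
Proof.
move=> cg ab H.
have sub : `]a, b]%classic `<=` `[a, b]%classic by apply: subset_itvr; rewrite bnd_simp.
have ig (h : R -> R) : continuous h -> leb.-integrable `]a, b] (EFin \o h).
  by move=> ch; apply: integrableS (continuous_itv_integrable a b ch).
have ic r : \int[leb]_(t in `]a, b]) r = r * (b - a).
  have em : leb `]a, b]%classic = (b - a)%:E.
    rewrite lebesgue_measure_itv/= lte_fin EFinB.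
    by case: ltgtP ab => // -> _; rewrite -EFinB subrr.
  rewrite Rintegral_cst//; congr (_ * _).
  by rewrite -[RHS]/(fine (b - a)%:E) -em.
have cc (r : R) : continuous (fun _ : R => r) by move=> x; apply: cst_continuous.
rewrite ler_norml lerBrDr lerBlDr -mulNr -!mulrDl -!ic; apply/andP; split.
  apply: le_Rintegral => //; [exact: ig|exact: ig|].
  by move=> t; rewrite /= in_itv /= => /H; rewrite ler_norml => /andP[]; lra.
apply: le_Rintegral => //; [exact: ig|exact: ig|].
by move=> t; rewrite /= in_itv /= => /H; rewrite ler_norml => /andP[]; lra.
Qed.

Lemma Rintegral_riemann (g : R -> R) (h eps : R) n : continuous g -> 0 <= h ->
  (forall (j : nat) t, (j < n)%N -> j%:R * h <= t <= j.+1%:R * h -> `|g t - g (j%:R * h)| <= eps) ->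
  `|\int[leb]_(t in `[0, n%:R * h]) g t - h * \sum_(j < n) g (j%:R * h)| <= n%:R * (eps * h).
Proof.
move=> cg h0; elim: n => [|n IH] H.
  by rewrite !mul0r big_ord0 mulr0 subr0 set_itv1 Rintegral_set1 normr0.
have IHn := IH (fun j t jn => H j t (ltnW jn)).
have le1 : n%:R * h <= n.+1%:R * h by rewrite ler_wpM2r// ler_nat.
have := @Rintegral_itvB _ g (BLeft 0) (BRight (n.+1%:R * h)) (n%:R * h)
  (continuous_itv_integrable _ _ cg).
rewrite !bnd_simp => /(_ _ le1) e.
have {}e : \int[leb]_(t in `[0, n.+1%:R * h]) g t =
   \int[leb]_(t in `[0, n%:R * h]) g t + \int[leb]_(t in `](n%:R * h), (n.+1%:R * h)]) g t.
  by rewrite -e ?mulr_ge0// addrC subrK.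
rewrite e big_ord_recr /= mulrDr.
have := @Rintegral_near_cst g (n%:R * h) (n.+1%:R * h) (g (n%:R * h)) eps cg le1.
rewrite (_ : n.+1%:R * h - n%:R * h = h); last by rewrite -natr1; ring.
move=> /(_ _) h2.
have {}h2 := h2 (fun t => _); rewrite (_ : n.+1%:R * (eps * h) = n%:R * (eps * h) + eps * h); last first.
  by rewrite -natr1; ring.
rewrite opprD addrACA (le_trans (ler_normD _ _))// lerD// (mulrC h) h2// => t /andP[t1 t2].
by apply: H => //; rewrite t2 ltW.
Qed.

Lemma riemann_unit_roots (f : C -> R) (eps : R) : continuous (f : C^o -> R) -> 0 < eps ->
  exists L0 : nat, forall L, (L0 <= L)%N -> (0 < L)%N ->
  `|circle_average f - L%:R^-1 * \sum_(z <- unit_roots L) f z| <= eps.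
Proof.
move=> cf eps0.
have [tau tau0 Htau] := unif_continuous_circle cf eps0.
have [d d0 Hd] := @cis_close R _ tau0.
pose g t := f (cis t).
have cg : continuous g.
  move=> t; apply/cvgrPdist_lt => e e0.
  have [r r0 Hr] := continuous_nrm (cis t) cf e0.
  have [d' d'0 Hd'] := @cis_close R _ r0.
  near=> t'; rewrite distrC; apply: Hr; apply: Hd'; rewrite distrC.
  by near: t'; exact: (@nbhsx_ballx _ _ t d' d'0).
have pi0 := pi_gt0 R.
exists (Num.trunc (2 * pi / d)).+1 => L LL L0.
have L0' : 0 < L%:R :> R by rewrite ltr0n.
pose h : R := 2 * pi / L%:R.
have h0 : 0 < h by rewrite divr_gt0// mulr_gt0.
have hd : h < d.
  rewrite ltr_pdivrMr// (mulrC d) -ltr_pdivrMr//.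
  apply: (lt_le_trans (truncnS_gt _)); by rewrite ler_nat.
have Hg (j : nat) t : (j < L)%N -> j%:R * h <= t <= j.+1%:R * h -> `|g t - g (j%:R * h)| <= eps.
  move=> jL /andP[t1 t2]; apply: Htau; first exact: norm_cis.
  apply: Hd; rewrite ger0_norm ?subr_ge0//; move: t2; rewrite -natr1; lra.
have := @Rintegral_riemann g h eps L cg (ltW h0) Hg.
have -> : L%:R * h = 2 * pi by rewrite /h mulrCA divff ?mulr1// gt_eqF.
have -> : \sum_(j < L) g (j%:R * h) = \sum_(z <- unit_roots L) f z.
  rewrite big_map (_ : iota 0 L = index_iota 0 L) ?big_mkord; last by rewrite /index_iota subn0.
  by apply: eq_bigr => j _; rewrite /g cis_natM.
set S := \sum_(_ <- _) _; rewrite -/(circle_average f) => H.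
rewrite /circle_average -/(g _).
set I := \int[_]_(_ in _) _ in H *.
have gen (p l I' S' : R) : 0 < p -> 0 < l ->
    (2 * p)^-1 * I' - l^-1 * S' = (2 * p)^-1 * (I' - 2 * p / l * S').
  by move=> p0 l0; field; rewrite !gt_eqF.
have gen2 (p l e : R) : 0 < p -> 0 < l -> l * (e * (2 * p / l)) = e * (2 * p).
  by move=> p0 l0; field; rewrite gt_eqF.
rewrite gen// normrM gtr0_norm ?invr_gt0 ?mulr_gt0//.
rewrite mulrC ler_pdivrMr ?mulr_gt0//; apply: (le_trans H).
by rewrite gen2.
Unshelve. all: by end_near. Qed.

End Riemann.

(** * Roots in the disk *)

Section Disk.
Context {R : realType}.
Local Notation C := R[i].
Local Notation toC := (real_complex R).

Lemma nrm_prod (zs : seq C) : nrm (\prod_(z <- zs) z) = \prod_(z <- zs) nrm z.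
Proof.
elim: zs => [|z zs IH]; first by rewrite !big_nil /nrm normr1.
by rewrite !big_cons nrmM IH.
Qed.

Lemma sum_one_sub_nrm (zs : seq C) (x : R) :
  expR (- x) <= nrm (\prod_(z <- zs) z) -> \sum_(z <- zs) (1 - nrm z) <= x.
Proof.
move=> h; rewrite -lerN2 -ler_expR; apply: (le_trans h).
rewrite nrm_prod -sumrN; elim: zs {h} => [|z zs IH]; first by rewrite !big_nil expR0.
rewrite !big_cons expRD ler_pM ?nrm_ge0//.
  by apply: prodr_ge0 => i _; exact: nrm_ge0.
by have := expR_ge1Dx (- (1 - nrm z)); lra.
Qed.

Lemma one_sub_expr_le (r : R) m : 0 <= r <= 1 -> 1 - r ^+ m <= m%:R * (1 - r).
Proof.
move=> /andP[r0 r1]; elim: m => [|m IH]; first by rewrite expr0 subrr mul0r.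
rewrite -natr1 exprS; have h : 0 <= r ^+ m <= 1 by rewrite exprn_ge0//= exprn_ile1.
by case/andP: h => h1 h2; nra.
Qed.

Definition unitize (z : C) : C := z / `|z|.

Lemma norm_unitize z : z != 0 -> `|unitize z| = 1.
Proof. by move=> z0; rewrite normrM normfV normr_id divff// normr_eq0. Qed.

Lemma unitizeE z : z != 0 -> z = toC (nrm z) * unitize z.
Proof. by move=> z0; rewrite -nrmE mulrC divfK// normr_eq0. Qed.

Lemma disk_average (F : C -> R) (M eps tau B delta : R) n (zs es : seq C) :
  (0 < n)%N -> (0 < size zs)%N -> (0 < size es)%N ->
  (forall z, `|F z| <= M) -> 0 < tau -> 0 <= B -> 0 <= delta ->
  (forall z w, `|w| = 1 -> nrm (z - w) < tau -> `|F z - F w| <= eps) ->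
  (forall z, z \in zs -> `|z| <= 1) -> (forall z, z \in es -> `|z| = 1) ->
  (forall m, (0 < m < n)%N -> \sum_(z <- es) z ^+ m = 0) ->
  (forall m, (0 < m < n)%N -> `|\sum_(w <- zs) w ^+ m| <= toC (B * (size zs)%:R)) ->
  expR (- (delta * (size zs)%:R)) <= nrm (\prod_(z <- zs) z) ->
  `|(size zs)%:R^-1 * \sum_(w <- zs) F w - (size es)%:R^-1 * \sum_(z <- es) F z| <=
    (eps + 2 * M * (delta / tau)) +
    (eps + 2 * M * (4 / (n%:R * tau ^+ 2)) + M * (n%:R * (B + n%:R * delta))).
Proof.
move=> n0 zs0 es0 FM tau0 B0 delta0 Fu zs1 es1 esm zsm zprod.
set N := (size zs)%:R; have N0 : 0 < N :> R by rewrite ltr0n.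
have M0 : 0 <= M by apply: le_trans (FM 0).
have eps0 : 0 <= eps.
  by apply: le_trans (Fu 1 1 _ _); rewrite ?normr1// subrr /nrm normr0.
have zn0 z : z \in zs -> z != 0.
  move=> zzs; apply/eqP => z0; move: zprod.
  have -> : \prod_(z <- zs) z = 0.
    apply/eqP; rewrite prodf_seq_eq0; apply/hasP; exists z => //=.
    by rewrite z0.
  by rewrite /nrm normr0 /= leNgt expR_gt0.
have sumr := sum_one_sub_nrm zprod.
have r1 z : z \in zs -> 0 <= nrm z <= 1.
  by move=> zzs; rewrite nrm_ge0 nrm_le rmorph1 zs1.
pose ws := map unitize zs.
have wsN : size ws = size zs by rewrite size_map.
have ws1 w : w \in ws -> `|w| = 1.
  by move=> /mapP[z zzs ->]; rewrite norm_unitize// zn0.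
have wsm m : (0 < m < n)%N -> `|\sum_(w <- ws) w ^+ m| <= toC ((B + n%:R * delta) * (size ws)%:R).
  move=> mn; rewrite wsN big_map.
  rewrite (_ : \sum_(z <- zs) _ = \sum_(z <- zs) z ^+ m + \sum_(z <- zs) (unitize z ^+ m - z ^+ m)); last first.
    by rewrite -big_split /=; apply: eq_bigr => z _; rewrite addrC subrK.
  apply: (le_trans (ler_normD _ _)); rewrite mulrDl rmorphD lerD ?zsm//.
  apply: (@le_trans _ _ (\sum_(z <- zs) toC (n%:R * (1 - nrm z)))); last first.
    rewrite -rmorph_sum lecR -mulr_sumr -mulrA ler_wpM2l//.
  apply: (le_trans (ler_norm_sum _ _ _)); rewrite big_seq [leRHS]big_seq.
  apply: ler_sum => z zzs.
  have -> : unitize z ^+ m - z ^+ m = (1 - toC (nrm z) ^+ m) * unitize z ^+ m.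
    by rewrite mulrBl mul1r -exprMn -unitizeE// zn0.
  rewrite normrM normrX.
  rewrite norm_unitize ?zn0// expr1n mulr1 -rmorphXn -(rmorph1 toC) -rmorphB normr_toC lecR.
  have /andP[r0 r1'] := r1 z zzs.
  rewrite ger0_norm ?subr_ge0 ?exprn_ile1//.
  apply: (le_trans (one_sub_expr_le m (r1 z zzs))).
  by rewrite ler_wpM2r ?subr_ge0// ler_nat ltnW//; case/andP: mn.
have A1 : `|N^-1 * \sum_(z <- zs) F z - N^-1 * \sum_(w <- ws) F w| <= eps + 2 * M * (delta / tau).
  rewrite -mulrBr normrM gtr0_norm ?invr_gt0// mulrC ler_pdivrMr//.
  rewrite big_map -sumrB; apply: (le_trans (ler_norm_sum _ _ _)).
  apply: (@le_trans _ _ (\sum_(z <- zs) (eps + 2 * M / tau * (1 - nrm z)))); last first.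
    rewrite big_split /= sumr_const_seq -mulr_sumr [leRHS]mulrDl -[X in X + _ <= _]mulr_natr; apply: lerD => //.
    rewrite (_ : 2 * M * (delta / tau) * N = 2 * M / tau * (delta * N)); last by ring.
    by rewrite ler_wpM2l// divr_ge0 ?mulr_ge0// ltW.
  rewrite big_seq [leRHS]big_seq; apply: ler_sum => z zzs.
  have /andP[r0 r1'] := r1 z zzs.
  have e : nrm (z - unitize z) = 1 - nrm z.
    apply: (@complexI R); rewrite -nrmE.
    have -> : z - unitize z = (toC (nrm z) - 1) * unitize z.
      by rewrite mulrBl mul1r -unitizeE// zn0.
    rewrite normrM norm_unitize ?zn0// mulr1.
    rewrite -(rmorph1 toC) -rmorphB normr_toC ler0_norm ?subr_le0//.
    by rewrite opprB.
  have T0 : 0 <= 2 * M / tau * (1 - nrm z).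
    by rewrite mulr_ge0 ?subr_ge0// divr_ge0 ?mulr_ge0// ltW.
  have [far|near] := leP tau (nrm (z - unitize z)); last first.
    by apply: (le_trans (Fu _ _ _ near)); [rewrite norm_unitize ?zn0|lra].
  have fm : `|F z - F (unitize z)| <= 2 * M.
    by rewrite mulr_natl mulr2n (le_trans (ler_normB _ _))// lerD.
  rewrite e in far; apply: (le_trans fm).
  have : 2 * M <= 2 * M / tau * (1 - nrm z).
    by rewrite mulrAC ler_pdivlMr// ler_wpM2l// mulr_ge0.
  by lra.
have Bd0 : 0 <= B + n%:R * delta by rewrite addr_ge0 ?mulr_ge0.
have A2 : `|N^-1 * \sum_(w <- ws) F w - (size es)%:R^-1 * \sum_(z <- es) F z| <=
    eps + 2 * M * (4 / (n%:R * tau ^+ 2)) + M * (n%:R * (B + n%:R * delta)).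
  rewrite /N -wsN; apply: weyl_fejer => //; first by rewrite wsN.
  by move=> u v _ v1; exact: Fu.
rewrite (_ : _ - _ = (N^-1 * \sum_(z <- zs) F z - N^-1 * \sum_(w <- ws) F w) +
  (N^-1 * \sum_(w <- ws) F w - (size es)%:R^-1 * \sum_(z <- es) F z)); last by ring.
by rewrite (le_trans (ler_normD _ _))// lerD.
Qed.

Lemma root_average_close (f : C -> R) (eps : R) :
  (exists M : R, forall z : C, `|f z| <= M) -> continuous (f : C^o -> R) -> 0 < eps ->
  exists2 delta : R, 0 < delta & forall N (a : N.-tuple R), (0 < N)%N ->
    Omega R N a -> (forall i, (i < N)%N -> `|nth 0 (refl N a) i| < 1) ->
    \sum_(k <- refl N a) `|k| <= delta * N%:R ->
    expR (- (delta * N%:R)) <= `|nth 0 a N.-1| ->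
    `|root_average f a - circle_average f| <= eps.
Proof.
move=> [M0 HM0] cf eps0.
pose M := Num.max M0 1.
have M1 : 1 <= M by rewrite le_max lexx orbT.
have HM z : `|f z| <= M by rewrite (le_trans (HM0 z))// le_max lexx.
have e8 : 0 < eps / 8 by rewrite divr_gt0.
have [tau tau0 Htau] := unif_continuous_circle cf e8.
have [L0 HL0] := riemann_unit_roots cf e8.
pose n := (Num.trunc (2 * M * 4 / (tau ^+ 2 * (eps / 8)))).+1.
have t20 : 0 < tau ^+ 2 by rewrite exprn_gt0.
have n0 : 0 < n%:R :> R by rewrite ltr0n.
have nT : 2 * M * (4 / (n%:R * tau ^+ 2)) <= eps / 8.
  have : 2 * M * 4 / (tau ^+ 2 * (eps / 8)) < n%:R by exact: truncnS_gt.
  rewrite ltr_pdivrMr ?(mulr_gt0 t20)// mulrA [in X in _ -> X]mulrA => h.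
  rewrite ler_pdivrMr ?mulr_gt0//; move: h; lra.
pose L := maxn L0 n.
have Ln : (n <= L)%N by rewrite leq_maxr.
have L0' : (0 < L)%N by apply: leq_trans Ln.
pose K : R := 2 * M / tau + M * (n%:R * (logder_bound n + n%:R)).
have K0 : 0 < K.
  have Mp : 0 < M by rewrite (lt_le_trans ltr01).
  have lb0 : 0 <= logder_bound n :> R by exact: logder_bound_ge0.
  apply: ltr_wpDr; last by rewrite divr_gt0// mulr_gt0.
  by rewrite mulr_ge0 ?(ltW Mp)// mulr_ge0// addr_ge0.
pose delta := eps / 8 / K.
have delta0 : 0 < delta by rewrite divr_gt0.
exists delta => // N a N0 Oa Ha Hsum Hlast.
have N0' : 0 < N%:R :> R by rewrite ltr0n.
set rs := croots a.
have rsN : size rs = N by exact: size_croots.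
have Prs : cpol a = \prod_(z <- rs) ('X - z%:P) by rewrite -croots_prod cpoly_of_coefs_pol.
have rs1 z : z \in rs -> `|z| <= 1.
  by move=> zrs; apply: Oa; rewrite cpoly_of_coefs_pol Prs root_prod_XsubC.
have prodE : nrm (\prod_(z <- rs) z) = `|nth 0 a N.-1|.
  have : (cpol a).[0] = toC (nth 0 a N.-1).
    rewrite horner_coef0 coef_map /=; congr (toC _).
    rewrite coef_Poly nth_rev //= subSS subn0 size_tuple.
    by move: (tval a) => s; case: (N) N0.
  rewrite Prs horner_prod => e; apply: (@complexI R); rewrite -normr_toC -e -nrmE.
  by rewrite !normr_prod; apply: eq_bigr => z _; rewrite hornerXsubC sub0r normrN.
have := @disk_average f M (eps / 8) tau (logder_bound n * delta) delta n rs (unit_roots L).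
rewrite rsN size_unit_roots => /(_ _ N0 L0' HM tau0 _ (ltW delta0) Htau rs1 (@norm_unit_roots R L)).
have lb0 : 0 <= logder_bound n :> R by exact: logder_bound_ge0.
move=> /(_ isT); rewrite mulr_ge0// ?(ltW delta0)// => /(_ isT).
have esm m : (0 < m < n)%N -> \sum_(z <- unit_roots L) z ^+ m = 0 :> C.
  by move=> /andP[m0 mn]; apply: sum_unit_roots; rewrite m0 (leq_trans mn).
move=> /(_ esm).
have psm m : (0 < m < n)%N -> `|\sum_(w <- rs) w ^+ m| <= toC (logder_bound n * delta * N%:R).
  case: m => // m /= mn.
  have := @power_sum_le R n N a rs m (size_tuple a) (ltnW mn) Prs.
  rewrite size_tuple => /(_ rsN Ha) h; apply: (le_trans h).
  by rewrite lecR -mulrA ler_wpM2l.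
move=> /(_ psm); rewrite prodE => /(_ Hlast) h1.
have h2 := HL0 L (leq_maxl _ _) L0'.
have h3 : 2 * M * (delta / tau) + M * (n%:R * (logder_bound n * delta + n%:R * delta)) = eps / 8.
  have gen (d : R) : 2 * M * (d / tau) + M * (n%:R * (logder_bound n * d + n%:R * d)) = K * d.
    by rewrite /K; ring.
  by rewrite gen /delta mulrC divfK// gt_eqF.
rewrite /root_average -/rs.
rewrite -(subrK (L%:R^-1 * \sum_(z <- unit_roots L) f z) (N%:R^-1 * _)) -addrA.
apply: (le_trans (ler_normD _ _)).
rewrite distrC in h2; move: h1 h2 h3 nT; lra.
Qed.

End Disk.

(** * The densities of the reflection coefficients *)

Section Weights.
Context {R : realType}.
Local Notation mR := (measurableTypeR R).
Local Notation leb := (@lebesgue_measure R).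
Implicit Types (k : R) (n i : nat).

Lemma mix_jacobian_le2 n k : `|k| <= 1 -> mix_jacobian n k <= 2.
Proof.
rewrite ler_norml => /andP[a b]; rewrite /mix_jacobian -[leRHS]mul1r ler_pM//.
- by apply: exprn_ge0; nra.
- by apply: exprn_ge0; lra.
- by apply: exprn_ile1; nra.
- by case: (odd n); rewrite ?expr1 ?expr0; lra.
Qed.

Lemma mix_jacobian_ge n k : 0 <= k <= (2 * n.+1%:R)^-1 -> 1 / 2 <= mix_jacobian n k.
Proof.
have n1 : 1 <= n.+1%:R :> R by rewrite ler1n.
have np : 0 < 2 * n.+1%:R :> R by lra.
move=> /andP[k0 kn].
have kn' : k * (2 * n.+1%:R) <= 1 by rewrite -ler_pdivlMr// div1r.
have k2 : k <= 1 / 2 by nra.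
have h0 : (n./2)%:R <= n.+1%:R :> R by rewrite ler_nat; lia.
have := @one_sub_expr_le R (1 - k ^+ 2) n./2; move=> /(_ _) h.
have {}h : 1 - (1 - k ^+ 2) ^+ n./2 <= (n./2)%:R * (1 - (1 - k ^+ 2)).
  by apply: h; apply/andP; split; nra.
have h2 : (n./2)%:R * (1 - (1 - k ^+ 2)) <= 1 / 2.
  apply: (@le_trans _ _ (n.+1%:R * k ^+ 2)); last by nra.
  rewrite (_ : 1 - (1 - k ^+ 2) = k ^+ 2); last by ring.
  by apply: ler_wpM2r => //; exact: sqr_ge0.
rewrite /mix_jacobian -[leLHS]mulr1 ler_pM//; last first.
  by case: (odd n); rewrite ?expr1 ?expr0; lra.
by lra.
Qed.

Lemma measurable_mix_jacobian n : measurable_fun setT (@mix_jacobian R n).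
Proof.
apply: measurable_funM.
  by apply: measurable_funX; apply: measurable_funB => //; exact: measurable_funX.
by apply: measurable_funX; apply: measurable_funD.
Qed.

Lemma mem_open_itv k : k \in `](- 1), 1[ -> `|k| < 1.
Proof. by rewrite in_itv /= ltr_norml. Qed.

Local Open Scope ereal_scope.

Lemma integral_open_itv (h : R -> R) : measurable_fun setT h ->
  (forall k, (0 <= h k)%R) -> (forall k, (1 < `|k|)%R -> h k = 0%R) ->
  \int[leb]_k (h k)%:E = \int[leb]_(k in `](- 1)%R, 1%R[) (h k)%:E.
Proof.
move=> mh h0 hout; rewrite [RHS]integral_mkcond.
have mS : measurable (`](- 1)%R, 1%R[%classic : set R) by exact: measurable_itv.
have mh' : measurable_fun setT (fun k : R => (h k)%:E) by exact/measurable_EFinP.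
apply: ge0_ae_eq_integral => //.
- by apply/measurable_restrict => //; rewrite setTI; exact: measurable_funS mh'.
- by move=> k _; rewrite lee_fin.
- by move=> k _; rewrite patchE; case: ifP => // _; rewrite lee_fin.
exists ([set 1%R] `|` [set (-1)%R]); split.
- by apply: measurableU; exact: measurable_set1.
- apply/eqP; rewrite eq_le measure_ge0 andbT.
  rewrite (le_trans (measureU2 _ _ _))//; try exact: measurable_set1.
  have e (x : R) : leb [set x] = 0 by exact: lebesgue_measure_set1.
  by rewrite [X in X + _ <= _]e [X in _ + X <= _]e adde0.
move=> k /=; apply: contra_notP => /not_orP[/eqP k1 /eqP k2] _.
rewrite patchE; case: ifPn => // /negP kS; rewrite hout//.
rewrite lt_neqAle leNgt; apply/andP; split.
  by rewrite eq_sym; apply/eqP => /eqP; rewrite eqr_norml (negbTE k1) (negbTE k2).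
by apply/negP => h1; apply: kS; rewrite inE /= in_itv /= -ltr_norml.
Qed.

Definition jac_int n : \bar R := \int[leb]_(k in `](- 1)%R, 1%R[) (mix_jacobian n k)%:E.

Lemma lebesgue_measure_le_itv (a b : R) (bl br : bool) : (a <= b)%R ->
  leb [set` Interval (BSide bl a) (BSide br b)] = (b - a)%:E.
Proof.
move=> ab; rewrite lebesgue_measure_itv/= lte_fin EFinB.
by case: ltgtP ab => // -> _; rewrite -EFinB subrr.
Qed.

Lemma integral_itv_le (a b M : R) (h : R -> R) (bl br : bool) : (a <= b)%R ->
  measurable_fun setT h ->
  (forall k, k \in Interval (BSide bl a) (BSide br b) -> (0 <= h k <= M)%R) ->
  \int[leb]_(k in [set` Interval (BSide bl a) (BSide br b)]) (h k)%:E <= (M * (b - a))%:E.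
Proof.
move=> ab mh H.
have mS : measurable ([set` Interval (BSide bl a) (BSide br b)] : set R) by exact: measurable_itv.
apply: (@le_trans _ _ (\int[leb]_(k in [set` Interval (BSide bl a) (BSide br b)]) (cst M%:E) k)).
  apply: ge0_le_integral => //=.
  - by move=> k /= /H /andP[]; rewrite lee_fin.
  - by apply/measurable_EFinP; exact: measurable_funTS.
  - by move=> k /= /H /andP[_]; rewrite lee_fin.
rewrite integral_cst// EFinM le_eqVlt; apply/orP; left; apply/eqP; congr (_ * _).
exact: lebesgue_measure_le_itv.
Qed.

Lemma jac_int_le4 n : jac_int n <= 4%:E.
Proof.
have := @integral_itv_le (-1) 1 2 (mix_jacobian n) false true.
rewrite (_ : 2 * (1 - -1) = 4)%R; last by ring.
apply; [by lra|exact: measurable_mix_jacobian|].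
by move=> k /mem_open_itv k1; rewrite mix_jacobian_ge0 ?mix_jacobian_le2// ltW.
Qed.

Lemma jac_int_ge n : (4 * n.+1%:R)^-1%:E <= jac_int n.
Proof.
have n1 : (1 <= n.+1%:R :> R)%R by rewrite ler1n.
have q0 : (0 < (2 * n.+1%:R)^-1 :> R)%R by rewrite invr_gt0; lra.
have q1 : ((2 * n.+1%:R)^-1 < 1 :> R)%R by rewrite invf_lt1; lra.
have mJ := measurable_mix_jacobian n.
have mS : measurable (`[0%R, (2 * n.+1%:R)^-1%R] : set R) by exact: measurable_itv.
apply: (@le_trans _ _ (\int[leb]_(k in `[0%R, (2 * n.+1%:R)^-1%R]) (mix_jacobian n k)%:E)); last first.
  apply: ge0_subset_integral => //.
  - by apply/measurable_EFinP; exact: measurable_funTS.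
  - by move=> k /= /mem_open_itv k1; rewrite lee_fin mix_jacobian_ge0// ltW.
  - by move=> k /=; rewrite !in_itv /= => /andP[k0 k1]; apply/andP; split; [lra|exact: le_lt_trans q1].
apply: (@le_trans _ _ (\int[leb]_(k in `[0%R, (2 * n.+1%:R)^-1%R]) (cst (1 / 2)%:E) k)); last first.
  apply: ge0_le_integral.
  - exact: mS.
  - by move=> k _; rewrite /= lee_fin.
  - exact: measurable_cst.
  - by apply/measurable_EFinP; exact: measurable_funTS.
  - by move=> k /=; rewrite in_itv /= lee_fin => /mix_jacobian_ge.
rewrite integral_cst//.
apply: (@le_trans _ _ ((1 / 2)%:E * ((2 * n.+1%:R)^-1 - 0)%:E)).
  rewrite -EFinM lee_fin le_eqVlt; apply/orP; left; apply/eqP.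
  by field; rewrite /= nat1r pnatr_eq0.
rewrite le_eqVlt; apply/orP; left; apply/eqP; congr (_ * _); apply/esym.
by apply: lebesgue_measure_le_itv; exact: ltW.
Qed.

Definition jac n : R := fine (jac_int n).

Lemma jac_intE n : jac_int n = (jac n)%:E.
Proof.
rewrite /jac fineK// ge0_fin_numE; first by apply: le_lt_trans (jac_int_le4 n) _; rewrite ltry.
by apply: le_trans (jac_int_ge n); rewrite lee_fin invr_ge0 mulr_ge0.
Qed.

Lemma jac_le4 n : (jac n <= 4)%R.
Proof. by rewrite -lee_fin -jac_intE jac_int_le4. Qed.

Lemma jac_ge n : ((4 * n.+1%:R)^-1 <= jac n)%R.
Proof. by rewrite -lee_fin -jac_intE jac_int_ge. Qed.

Lemma jac_gt0 n : (0 < jac n)%R.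
Proof. by apply: lt_le_trans (jac_ge n); rewrite invr_gt0 mulr_gt0. Qed.

Lemma integral_gjac_open (g : R -> R) n : measurable_fun setT g ->
  (forall k, (0 <= g k)%R) -> (forall k, (1 < `|k|)%R -> g k = 0%R) ->
  \int[leb]_k (g k * mix_jacobian n k)%:E =
  \int[leb]_(k in `](- 1)%R, 1%R[) (g k * mix_jacobian n k)%:E.
Proof.
move=> mg g0 gout; apply: integral_open_itv.
- by apply: measurable_funM => //; exact: measurable_mix_jacobian.
- move=> k; have [k1|k1] := leP `|k|%R 1%R; last by rewrite gout// mul0r.
  by rewrite mulr_ge0// mix_jacobian_ge0.
- by move=> k k1; rewrite gout// mul0r.
Qed.

Lemma integral_gjac_one (g : R -> R) n : measurable_fun setT g ->
  (forall k, (0 <= g k)%R) -> (forall k, (1 < `|k|)%R -> g k = 0%R) ->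
  (forall k, (`|k| < 1)%R -> g k = 1%R) ->
  \int[leb]_k (g k * mix_jacobian n k)%:E = (jac n)%:E.
Proof.
move=> mg g0 gout g1; rewrite integral_gjac_open// -jac_intE.
by apply: eq_integral => k; rewrite inE /= => /mem_open_itv k1; rewrite g1// mul1r.
Qed.

Lemma integral_gjac_inv (g : R -> R) n : measurable_fun setT g ->
  (forall k, (0 <= g k)%R) -> (forall k, (1 < `|k|)%R -> g k = 0%R) ->
  (forall k, (`|k| < 1)%R -> g k = (1 - k ^+ 2)^-1%R) ->
  \int[leb]_k (g k * mix_jacobian n.+2 k)%:E = (jac n)%:E.
Proof.
move=> mg g0 gout g1; rewrite integral_gjac_open// -jac_intE.
apply: eq_integral => k; rewrite inE /= => /mem_open_itv k1; rewrite g1//.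
congr (_%:E); have := one_sub_sqr_gt0 k1; rewrite /mix_jacobian /= negbK.
move: (1 - k ^+ 2)%R => u u0.
by rewrite exprS -[X in (_ * X)%R]mulrA mulKf// gt_eqF.
Qed.

Lemma integral_gjac_small (g : R -> R) n (eta : R) : (0 <= eta <= 1)%R ->
  measurable_fun setT g ->
  (forall k, (0 <= g k <= 1)%R) -> (forall k, (eta < `|k|)%R -> g k = 0%R) ->
  \int[leb]_k (g k * mix_jacobian n k)%:E <= (4 * eta)%:E.
Proof.
move=> /andP[e0 e1] mg g01 gout.
have gJ k : k \in `[(- eta)%R, eta] -> (0 <= g k * mix_jacobian n k <= 2)%R.
  rewrite in_itv /= -ler_norml => k1; have /andP[a b] := g01 k.
  have k1' : (`|k| <= 1)%R by rewrite (le_trans k1).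
  have := mix_jacobian_ge0 n k1'; have := mix_jacobian_le2 n k1' => c d.
  by apply/andP; split; nra.
have := @integral_itv_le (- eta) eta 2 (fun k => g k * mix_jacobian n k)%R true false.
rewrite (_ : 2 * (eta - - eta) = 4 * eta)%R; last by ring.
move=> H; apply: le_trans (H _ _ gJ); last 2 first.
- by lra.
- by apply: measurable_funM => //; exact: measurable_mix_jacobian.
rewrite [leRHS]integral_mkcond le_eqVlt; apply/orP; left; apply/eqP.
apply: eq_integral => k _; rewrite patchE; case: ifPn => //.
rewrite notin_setE /= in_itv /= -ler_norml => /negP; rewrite -ltNge => /gout ->.
by rewrite mul0r.
Qed.

Lemma integral_gjac0 (a b : R) (g : R -> R) : (a <= b)%R ->
  (forall k, g k = if (a < k < b)%R then 1 else 0)%R ->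
  \int[leb]_k (g k * mix_jacobian 0 k)%:E = (b - a)%:E.
Proof.
move=> ab gE.
rewrite (eq_integral (fun k : mR => (\1_(`]a, b[%classic : set R) k)%:E)); last first.
  move=> k _; rewrite gE /mix_jacobian /= !expr0 !mulr1 indicE.
  rewrite (_ : (k \in _) = (a < k < b)%R); first by case: ifP.
  by apply/idP/idP; rewrite inE /= in_itv.
have mS : measurable (`]a, b[%classic : set mR) by exact: measurable_itv.
rewrite (integral_indic leb measurableT mS) setIT; exact: lebesgue_measure_le_itv.
Qed.

End Weights.

(** * Weights on reflection coefficients *)

Section Events.
Context {R : realType}.
Local Notation mR := (measurableTypeR R).
Local Notation leb := (@lebesgue_measure R).
Implicit Types (k : R) (n i : nat).

Lemma unmix_degenerate k (s : seq R) : `|k| = 1 -> unmix k s = nseq (size s) 0.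
Proof.
move=> k1; apply: (@eq_from_nth _ 0); first by rewrite size_unmix size_nseq.
move=> i; rewrite size_unmix => ilt; rewrite nth_unmix// nth_nseq ilt.
by rewrite -(real_normK (num_real k)) k1 expr1n subrr invr0 mulr0.
Qed.

Lemma stable_nseq0 n : stable (nseq n (0 : R)).
Proof.
move=> z /rootP; have [rs Ps rsn] := cpol_roots (nseq n (0 : R)).
rewrite (_ : cpol _ = 'X^n); last first.
  apply/polyP => i; rewrite cpolE coef_Poly rev_cons -map_rev rev_nseq nth_rcons.
  rewrite size_map size_nseq map_nseq nth_nseq coefXn rmorph0.
  by case: ltngtP.
rewrite hornerXn => /eqP; rewrite expf_eq0 => /andP[_ /eqP->].
by rewrite normr0 ler01.
Qed.

Lemma stable_refl_le1 n (s : seq R) : size s = n -> stable s ->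
  forall i, (i < n)%N -> `|nth 0 (refl n s) i| <= 1.
Proof.
elim: n s => // n IH s; case/lastP: s => // s k; rewrite size_rcons => -[sn] st i.
have k1 := stable_last st.
rewrite refl_rcons// nth_rcons size_refl ltnS leq_eqVlt => /predU1P[->|ilt].
  by rewrite ltnn eqxx.
rewrite ilt; apply: IH => //; first by rewrite size_unmix.
move: k1; rewrite le_eqVlt => /predU1P[k1|k1]; last exact: stable_unmix.
by rewrite unmix_degenerate//; exact: stable_nseq0.
Qed.

Lemma nth_refl_last n (s : seq R) : nth 0 (refl n.+1 s) n = nth 0 s n.
Proof. by rewrite /= nth_rcons size_refl ltnn eqxx. Qed.

Lemma Omega_stable n (a : n.-tuple R) : Omega R n a -> stable a.
Proof. by move=> Oa z rz; apply: Oa; rewrite cpoly_of_coefs_pol. Qed.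

(* For |k| = 1 division by zero turns [unmix k] into 0, so a large sum of |k_i|
   need not show in the later factors: the weight charges that null set with c. *)
Definition spread_weight (c : R) i k : R :=
  if `|k| == 1 then c else
  if `|k| < 1 then (if (i < 2)%N then 1 else (1 - k ^+ 2)^-1) else 0.

Lemma spread_weight_ge0 c i k : 0 <= c -> 0 <= spread_weight c i k.
Proof.
move=> c0; rewrite /spread_weight; case: ifP => // _; case: ifP => // k1.
by case: ifP => // _; rewrite invr_ge0 ltW// one_sub_sqr_gt0.
Qed.

Lemma measurable_spread_weight c i : measurable_fun setT (spread_weight c i).
Proof.
apply: measurable_fun_ifT; first by apply: measurable_fun_eqr => //; exact: normr_measurable.
  exact: measurable_cst.
apply: measurable_fun_ifT; last exact: measurable_cst.
  by apply: measurable_fun_ltr => //; exact: normr_measurable.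
case: (i < 2)%N; first exact: measurable_cst.
apply: (measurableT_comp measurable_inv); apply: measurable_funB => //.
Qed.

Lemma spread_weight_out c i k : 1 < `|k| -> spread_weight c i k = 0.
Proof. by move=> k1; rewrite /spread_weight gt_eqF// ltNge ltW. Qed.

Lemma spread_weight_ge c i k : 1 <= c -> `|k| <= 1 ->
  1 <= spread_weight c i k.
Proof.
move=> c1; rewrite /spread_weight le_eqVlt => /predU1P[->|k1]; first by rewrite eqxx.
rewrite lt_eqF// k1; case: ifP => // _.
by rewrite invf_ge1 ?one_sub_sqr_gt0// gerBl sqr_ge0.
Qed.

Lemma spread_weight_expR c i k : `|k| < 1 ->
  expR (k ^+ 2 - (i < 2)%N%:R) <= spread_weight c i k.
Proof.
move=> k1; rewrite /spread_weight lt_eqF// k1.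
have k2 := one_sub_sqr_gt0 k1.
case: (i < 2)%N => /=; first by rewrite -[leRHS]expR0 ler_expR; lra.
rewrite subr0 -[expR _]invrK -expRN lef_pV2 ?posrE ?expR_gt0//.
by have := expR_ge1Dx (- k ^+ 2).
Qed.

Lemma prod_ge_one_factor (n : nat) (F : 'I_n -> R) (j : 'I_n) :
  (forall i : 'I_n, 1 <= F i) -> F j <= \prod_(i < n) F i.
Proof.
move=> F1; rewrite (bigD1 j)//= ler_peMr ?(le_trans ler01)//.
by elim/big_ind: _ => // x y x1 y1; rewrite -[leLHS]mulr1 ler_pM.
Qed.

Lemma spread_weight_event (delta : R) n (a : n.-tuple R) : 0 < delta -> Omega R n a ->
  ~ ((forall i, (i < n)%N -> `|nth 0 (refl n a) i| < 1) /\
     \sum_(k <- refl n a) `|k| <= delta * n%:R) ->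
  expR (delta ^+ 2 * n%:R - 2) <= refl_prod n (spread_weight (expR (delta ^+ 2 * n%:R))) a.
Proof.
move=> d0 Oa H; set c := expR (delta ^+ 2 * n%:R).
have c1 : 1 <= c by rewrite -expR0 ler_expR mulr_ge0// sqr_ge0.
have le1 := stable_refl_le1 (size_tuple a) (Omega_stable Oa).
have [nondeg|/existsNP[j /not_implyP[jn /negP]]] :=
    pselect (forall i, (i < n)%N -> `|nth 0 (refl n a) i| < 1); last first.
  rewrite -leNgt => k1; have {}k1 : `|nth 0 (refl n a) j| = 1.
    by apply/eqP; rewrite eq_le k1 le1.
  apply: (@le_trans _ _ c); first by rewrite ler_expR; lra.
  have ec : c = spread_weight c j (nth 0 (refl n a) j) by rewrite /spread_weight k1 eqxx.
  rewrite [leLHS]ec.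
  rewrite /refl_prod; apply: (@prod_ge_one_factor n (fun i : 'I_n => spread_weight c i (nth 0 (refl n a) i)) (Ordinal jn)).
  by move=> i; apply: spread_weight_ge => //; exact: le1.
have {}H : delta * n%:R < \sum_(k <- refl n a) `|k|.
  by rewrite ltNge; apply/negP => h; apply: H.
rewrite (big_nth 0) size_refl big_mkord in H.
apply: (@le_trans _ _ (\prod_(i < n) expR (nth 0 (refl n a) i ^+ 2 - (i < 2)%N%:R))); last first.
  by apply: ler_prod => i _; rewrite expR_ge0 spread_weight_expR// nondeg.
rewrite -(big_morph expR (fun x y => expRD x y) (@expR0 R)) ler_expR sumrB lerB//; last first.
  case: n {a Oa H le1 nondeg c c1} => [|[|n]].
  - by rewrite big_ord0.
  - by rewrite big_ord_recl big_ord0 addr0 /=; lra.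
  - rewrite 2!big_ord_recl big1 ?addr0//= -(natrD _ 1 1).
have h i : `|nth 0 (refl n a) i| * (2 * delta) - delta ^+ 2 <= nth 0 (refl n a) i ^+ 2.
  rewrite -subr_ge0 -(real_normK (num_real (nth 0 (refl n a) i))).
  rewrite (_ : _ - _ = (`|nth 0 (refl n a) i| - delta) ^+ 2); last by ring.
  exact: sqr_ge0.
apply: (@le_trans _ _ (\sum_(i < n) (`|nth 0 (refl n a) i| * (2 * delta) - delta ^+ 2))); last first.
  by apply: ler_sum => i _; exact: h.
rewrite sumrB -mulr_suml sumr_const card_ord -[X in _ <= _ - X]mulr_natr.
move: H; set S := \sum_(i < n) _; move: (n%:R) S => x S h2; nra.
Qed.

Definition last_weight m (eta : R) i k : R :=
  if (`|k| <= 1) && ((i == m) ==> (`|k| <= eta)) then 1 else 0.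

Lemma last_weight01 m eta i k : 0 <= last_weight m eta i k <= 1.
Proof. by rewrite /last_weight; case: ifP => _; rewrite lexx ler01. Qed.

Lemma last_weight_ge0 m eta i k : 0 <= last_weight m eta i k.
Proof. by case/andP: (last_weight01 m eta i k). Qed.

Lemma last_weight_out m eta i k : 1 < `|k| -> last_weight m eta i k = 0.
Proof. by move=> k1; rewrite /last_weight leNgt k1. Qed.

Lemma measurable_last_weight m eta i : measurable_fun setT (last_weight m eta i).
Proof.
have ml c : measurable_fun setT (fun k : R => `|k| <= c).
  by apply: measurable_fun_ler => //; exact: normr_measurable.
apply: measurable_fun_ifT; [|exact: measurable_cst|exact: measurable_cst].
case: (i == m) => /=; first by apply: measurable_and.
rewrite (_ : (fun _ => _) = fun t : R => `|t| <= 1)//; by apply/funext => t; rewrite andbT.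
Qed.

Lemma last_weight_event (eta : R) m (a : m.+1.-tuple R) : Omega R m.+1 a ->
  `|nth 0 a m| <= eta -> 1 <= refl_prod m.+1 (last_weight m eta) a.
Proof.
move=> Oa h; have le1 := stable_refl_le1 (size_tuple a) (Omega_stable Oa).
rewrite /refl_prod big1// => i _; rewrite /last_weight le1//=.
by case: eqP => //= ->; rewrite -/(refl m.+1 a) nth_refl_last h.
Qed.

Definition perron_weight (t : R) i k : R :=
  if (if i == 0%N then - 1 - t < k < - 1 else `|k| < 1) then 1 else 0.

Lemma perron_weight_ge0 t i k : 0 <= perron_weight t i k.
Proof. by rewrite /perron_weight; case: ifP. Qed.

Lemma perron_weight_out t i k : (0 < i)%N -> 1 < `|k| -> perron_weight t i k = 0.
Proof. by move=> i0 k1; rewrite /perron_weight gtn_eqF// ltNge ltW. Qed.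

Lemma measurable_perron_weight t i : measurable_fun setT (perron_weight t i).
Proof.
apply: measurable_fun_ifT; [|exact: measurable_cst|exact: measurable_cst].
case: (i == 0)%N; last by apply: measurable_fun_ltr => //; exact: normr_measurable.
by apply: measurable_and; apply: measurable_fun_ltr.
Qed.

Lemma perron_weight_prod t n (s : seq R) :
  refl_prod n (perron_weight t) s = 0 \/
  (refl_prod n (perron_weight t) s = 1 /\
   forall i, (i < n)%N -> perron_refl t i (nth 0 (refl n s) i)).
Proof.
have [H|/existsNP[j /not_implyP[jn Hj]]] := pselect (forall i, (i < n)%N -> perron_refl t i (nth 0 (refl n s) i)).
  right; split => //; rewrite /refl_prod big1// => i _; rewrite /perron_weight.
  by have := H i (ltn_ord i); rewrite /perron_refl; case: ifP => _ ->.
left; apply/eqP/prodf_eq0; exists (Ordinal jn) => //=.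
by move: Hj; rewrite /perron_refl /perron_weight; case: ifP => _ /negP/negbTE ->.
Qed.

Local Open Scope ereal_scope.

Lemma measurable_refl_prod_tuple (g : nat -> R -> R) n :
  (forall i, measurable_fun setT (g i)) ->
  measurable_fun setT (fun t : n.-tuple mR => refl_prod n g t).
Proof.
move=> mg; apply: (@measurable_refl_prod _ _ mg _ _ n (fun t : n.-tuple mR => t)).
  by move=> t; exact: size_tuple.
by move=> i; exact: measurable_nth.
Qed.

Lemma markov_refl_prod (g : nat -> R -> R) n (c : R) :
  (forall i, measurable_fun setT (g i)) -> (forall i k, (0 <= g i k)%R) ->
  (forall i k, (0 < i)%N -> (1 < `|k|)%R -> g i k = 0%R) -> (0 < c)%R ->
  measurable [set t : n.-tuple mR | (c <= refl_prod n g t)%R] /\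
  c%:E * lebesgue_tuple n [set t | (c <= refl_prod n g t)%R] <=
    \prod_(i < n) \int[leb]_k (g i k * mix_jacobian i k)%:E.
Proof.
move=> mg g0 gout c0; have mH := @measurable_refl_prod_tuple g n mg.
split.
  have mb : measurable_fun setT (fun t : n.-tuple mR => (c <= refl_prod n g t)%R).
    by apply: measurable_fun_ler => //; exact: measurable_cst.
  have := mb measurableT [set true] I; rewrite setTI.
  by rewrite (_ : _ @^-1` _ = [set t : n.-tuple mR | (c <= refl_prod n g t)%R])//; apply/seteqP; split.
rewrite -integral_refl_prod//.
have mHE : measurable_fun setT (fun t : n.-tuple mR => (refl_prod n g t)%:E) by exact/measurable_EFinP.
have := le_integral_abse (lebesgue_tuple n) measurableT mHE c0.
rewrite setTI (_ : [set x | _] = [set t : n.-tuple mR | (c <= refl_prod n g t)%R]); last first.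
  by apply/seteqP; split=> t /=; rewrite lee_fin ger0_norm ?refl_prod_ge0.
move=> h; apply: (le_trans h); rewrite le_eqVlt; apply/orP; left; apply/eqP.
by apply: eq_integral => t _; rewrite /= ger0_norm// refl_prod_ge0.
Qed.

Lemma prod_EFin n (x : nat -> R) : \prod_(i < n) (x i)%:E = (\prod_(i < n) x i)%:E.
Proof. by apply/esym/big_morph. Qed.

End Events.

(** * Volume bounds *)

Section Bounds.
Context {R : realType}.
Local Notation mR := (measurableTypeR R).
Local Notation leb := (@lebesgue_measure R).
Implicit Types (m n i : nat).
Local Open Scope ereal_scope.

Lemma lebesgue_tuple_bad_le m (delta : R) (A : set (m.+2.-tuple R)) : (0 < delta)%R ->
  (forall a, A a -> Omega R m.+2 a ->
    ~ [/\ forall i, (i < m.+2)%N -> (`|nth 0%R (refl m.+2 a) i| < 1)%R,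
          (\sum_(k <- refl m.+2 a) `|k| <= delta * m.+2%:R)%R &
          (expR (- (delta * m.+2%:R)) <= `|nth 0%R a m.+1|)%R]) ->
  lebesgue_tuple m.+2 (A `&` Omega R m.+2) <=
    (16 * expR (2 - delta ^+ 2 * m.+2%:R) * (\prod_(i < m) jac i) +
     4 * expR (- (delta * m.+2%:R)) * (\prod_(i < m.+1) jac i))%:E.
Proof.
move=> d0 HA; set N : R := m.+2%:R.
have N0 : (0 < N)%R by rewrite ltr0n.
pose c := expR (delta ^+ 2 * N); have c0 : (0 <= c)%R by exact: expR_ge0.
pose eta := expR (- (delta * N)).
have eta01 : (0 <= eta <= 1)%R.
  by rewrite expR_ge0 -[leRHS]expR0 ler_expR oppr_le0 mulr_ge0// ltW.
have [mB1 hB1] := @markov_refl_prod R (spread_weight c) m.+2 (expR (delta ^+ 2 * N - 2))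
  (@measurable_spread_weight _ c) (fun i k => spread_weight_ge0 i k c0)
  (fun i k _ => @spread_weight_out _ c i k) (expR_gt0 _).
have [mB2 hB2] := @markov_refl_prod R (last_weight m.+1 eta) m.+2 1
  (@measurable_last_weight _ m.+1 eta) (@last_weight_ge0 _ m.+1 eta)
  (fun i k _ => @last_weight_out _ m.+1 eta i k) ltr01.
set B1 := [set _ | _] in mB1 hB1; set B2 := [set _ | _] in mB2 hB2.
apply: (@le_trans _ _ (lebesgue_tuple m.+2 (B1 `|` B2))).
  apply: lebesgue_tuple_mono => a [Aa Oa].
  have [small|big] := leP `|nth 0%R a m.+1|%R eta.
    by right; apply: last_weight_event.
  left; apply: spread_weight_event => // -[h1 h2]; apply: (HA a Aa Oa); split => //.
  exact: ltW.
apply: (le_trans (measureU2 _ mB1 mB2)); rewrite EFinD; apply: leeD; last first.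
  move: hB2; rewrite mul1e => /le_trans; apply.
  rewrite (_ : \prod_(i < m.+2) _ = \prod_(i < m.+1) (\int[leb]_k (last_weight m.+1 eta i k * mix_jacobian i k)%:E) *
     \int[leb]_k (last_weight m.+1 eta m.+1 k * mix_jacobian m.+1 k)%:E); last by rewrite big_ord_recr.
  rewrite (eq_bigr (fun i : 'I_m.+1 => (jac i)%:E)); last first.
    move=> i _; apply: integral_gjac_one.
    - exact: measurable_last_weight.
    - by move=> k; exact: last_weight_ge0.
    - by move=> k; exact: last_weight_out.
    - by move=> k k1; rewrite /last_weight ltW//= ltn_eqF.
  rewrite (@prod_EFin _ m.+1 jac) [leRHS]EFinM muleC; apply: lee_wpmul2r.
    by rewrite lee_fin; apply: prodr_ge0 => i _; rewrite ltW// jac_gt0.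
  apply: integral_gjac_small => //.
  - exact: measurable_last_weight.
  - by move=> k; exact: last_weight01.
  - move=> k ek; rewrite /last_weight eqxx /=.
    by rewrite [X in _ && X]leNgt ek andbF.
have e1 : \prod_(i < m.+2) \int[leb]_k (spread_weight c i k * mix_jacobian i k)%:E =
    (jac 0 * (jac 1 * \prod_(i < m) jac i))%:E.
  transitivity (\int[leb]_k (spread_weight c 0 k * mix_jacobian 0 k)%:E *
    (\int[leb]_k (spread_weight c 1 k * mix_jacobian 1 k)%:E *
     \prod_(i < m) \int[leb]_k (spread_weight c i.+2 k * mix_jacobian i.+2 k)%:E)).
    by rewrite !big_ord_recl.
  have out i := @spread_weight_out R c i.
  have ge0 i k := @spread_weight_ge0 R c i k c0.
  have ms i := @measurable_spread_weight R c i.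
  rewrite (integral_gjac_one 0%N (ms 0%N) (ge0 0%N) (out 0%N)); last first.
    by move=> k k1; rewrite /spread_weight lt_eqF// k1.
  rewrite (integral_gjac_one 1%N (ms 1%N) (ge0 1%N) (out 1%N)); last first.
    by move=> k k1; rewrite /spread_weight lt_eqF// k1.
  rewrite (eq_bigr (fun i : 'I_m => (jac i)%:E)); last first.
    move=> i _; apply: (integral_gjac_inv i (ms i.+2) (ge0 i.+2) (out i.+2)).
    by move=> k k1; rewrite /spread_weight lt_eqF// k1.
  by rewrite (@prod_EFin _ m jac) -!EFinM.
rewrite e1 in hB1.
pose X := lebesgue_tuple m.+2 B1; change (X <= (16 * expR (2 - delta ^+ 2 * N) * \prod_(i < m) jac i)%:E).
have {}hB1 : (expR (delta ^+ 2 * N - 2))%:E * X <= (jac 0 * (jac 1 * \prod_(i < m) jac i))%:E := hB1.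
have -> : X = (expR (2 - delta ^+ 2 * N))%:E * ((expR (delta ^+ 2 * N - 2))%:E * X).
  have e : (2 - delta ^+ 2 * N + (delta ^+ 2 * N - 2) = 0)%R by ring.
  by rewrite muleA -EFinM -expRD e expR0 mul1e.
apply: (@le_trans _ _ ((expR (2 - delta ^+ 2 * N))%:E * (jac 0 * (jac 1 * \prod_(i < m) jac i))%:E)).
  by apply: lee_wpmul2l => //; rewrite lee_fin expR_ge0.
rewrite -EFinM lee_fin; set P := (\prod_(i < m) _)%R.
have P0 : (0 <= P)%R by apply: prodr_ge0 => i _; rewrite ltW// jac_gt0.
have h : (jac 0 * (jac 1 * P) <= 16 * P)%R.
  rewrite mulrA ler_wpM2r//.
  have := @jac_le4 R 0; have := @jac_le4 R 1; have := @jac_gt0 R 0; have := @jac_gt0 R 1; nra.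
rewrite [leRHS](_ : _ = expR (2 - delta ^+ 2 * N) * (16 * P))%R; last by ring.
by apply: ler_wpM2l; first exact: expR_ge0.
Qed.

Lemma lebesgue_tuple_OmegaP_ge m (mu t : R) : (1 < mu)%R -> (0 < t)%R ->
  (t * (2 * mu) <= (mu - 1) ^+ 2)%R ->
  ((\prod_(i < m.+2) mu ^- i.+1) * (t * \prod_(i < m.+1) jac i.+1))%:E <=
  lebesgue_tuple m.+2 (OmegaP R m.+2).
Proof.
move=> mu1 t0 tmu.
have mu0 : (0 < mu)%R by rewrite (lt_trans ltr01).
pose w i : R := (mu ^- i.+1)%R; pose w' i : R := (mu ^+ i.+1)%R.
have w0 i : (0 < w i)%R by rewrite invr_gt0 exprn_gt0.
have wK s : wscale w (wscale w' s) = s.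
  apply: (@eq_from_nth _ 0%R); first by rewrite !size_wscale.
  by move=> i _; rewrite !nth_wscale /w /w' mulKf// gt_eqF// exprn_gt0.
have wK' s : wscale w' (wscale w s) = s.
  apply: (@eq_from_nth _ 0%R); first by rewrite !size_wscale.
  by move=> i _; rewrite !nth_wscale /w /w' mulVKf// gt_eqF// exprn_gt0.
pose g := perron_weight t.
have mg i : measurable_fun setT (g i) by exact: measurable_perron_weight.
have g0 i k : (0 <= g i k)%R by exact: perron_weight_ge0.
have gout i k : (0 < i)%N -> (1 < `|k|)%R -> g i k = 0%R by exact: perron_weight_out.
pose F (a : m.+2.-tuple mR) : R := refl_prod m.+2 g (wscale w' a).
have mH := @measurable_refl_prod_tuple R g m.+2 mg.
have mF : measurable_fun setT F.
  exact: (measurableT_comp mH (measurable_wscale w')).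
have F0 a : (0 <= F a)%R by exact: refl_prod_ge0.
pose S := [set a : m.+2.-tuple mR | (1 <= F a)%R].
have mS : measurable S.
  have mb : measurable_fun setT (fun a : m.+2.-tuple mR => (1 <= F a)%R).
    by apply: measurable_fun_ler => //; exact: measurable_cst.
  have := mb measurableT [set true] I; rewrite setTI.
  by rewrite (_ : _ @^-1` _ = S)//; apply/seteqP; split.
have SO : S `<=` OmegaP R m.+2.
  move=> a; rewrite /S /= /F.
  have [->|[_ HQ] _] := perron_weight_prod t m.+2 (wscale w' a); first by rewrite ler10.
  have := @perron_refl_OmegaP R mu t m.+1 [tuple of wscale w' a] mu1 tmu HQ.
  by rewrite (_ : [tuple of wscale _ _] = a)//; apply/val_inj => /=; exact: wK.
apply: (@le_trans _ _ (lebesgue_tuple m.+2 S)); last exact: lebesgue_tuple_mono.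
have -> : lebesgue_tuple m.+2 S = \int[lebesgue_tuple m.+2]_a (F a)%:E.
  rewrite -[S]setIT -(integral_indic _ measurableT mS); apply: eq_integral => a _.
  congr (_%:E); rewrite indicE; case: (boolP (a \in S)) => [/set_mem|/negP aS].
    rewrite /S /= /F => h.
    by have [e|[-> _]//] := perron_weight_prod t m.+2 (wscale w' a); move: h; rewrite e ler10.
  rewrite /F; have [->//|[e _]] := perron_weight_prod t m.+2 (wscale w' a).
  by exfalso; apply: aS; apply/mem_set; rewrite /S /= /F e.
have mFE : measurable_fun setT (fun a : m.+2.-tuple mR => (F a)%:E) by exact/measurable_EFinP.
rewrite (ge0_integral_wscale w0 mFE); last by move=> a; rewrite lee_fin.
rewrite EFinM (eq_integral (fun a : m.+2.-tuple mR => (refl_prod m.+2 g a)%:E)); last first.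
  by move=> a _; rewrite /F /= wK'.
rewrite integral_refl_prod//.
have -> : \prod_(i < m.+2) \int[leb]_k (g i k * mix_jacobian i k)%:E =
    (t * \prod_(i < m.+1) jac i.+1)%:E.
  transitivity (\int[leb]_k (g 0%N k * mix_jacobian 0 k)%:E *
     \prod_(i < m.+1) \int[leb]_k (g i.+1 k * mix_jacobian i.+1 k)%:E).
    by rewrite big_ord_recl.
  rewrite (@integral_gjac0 _ (- 1 - t)%R (- 1)%R); [|by lra|by []].
  rewrite (eq_bigr (fun i : 'I_m.+1 => (jac i.+1)%:E)); last first.
    move=> i _; apply: integral_gjac_one => //.
    - by move=> k; exact: gout.
    - by move=> k k1; rewrite /g /perron_weight /= k1.
  by rewrite (@prod_EFin _ m.+1 (fun i => jac i.+1)) -EFinM; congr ((_ * _)%:E); ring.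
by [].
Qed.

End Bounds.

(** * Decay of the probability *)

Section Final.
Context {R : realType}.

Lemma expR_decay n (c N : R) : 0 < c -> 0 < N ->
  expR (- (c * N)) <= n.+1`!%:R / (c ^+ n.+1 * N ^+ n.+1).
Proof.
move=> c0 N0; have x0 : 0 < c * N by rewrite mulr_gt0.
have f0 : 0 < n.+1`!%:R :> R by rewrite ltr0n fact_gt0.
have p0 : 0 < c ^+ n.+1 * N ^+ n.+1 by rewrite mulr_gt0 ?exprn_gt0.
rewrite expRN -[leRHS]invrK lef_pV2 ?posrE ?expR_gt0 ?invr_gt0 ?divr_gt0//.
rewrite invf_div -exprMn; have := expR_ge1Dxn n (ltW x0); lra.
Qed.

Lemma prod_wscale_ge m (mu : R) : mu = 1 + m.+2%:R ^- 2 ->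
  expR (- 1) <= \prod_(i < m.+2) mu ^- i.+1.
Proof.
move=> emu; pose N : R := m.+2%:R; have N0 : 0 < N by rewrite ltr0n.
have mu1 : 1 <= mu by rewrite emu lerDl invr_ge0 exprn_ge0// ltW.
have mu0 : 0 < mu by rewrite (lt_le_trans ltr01).
apply: (@le_trans _ _ (\prod_(i < m.+2) mu ^- m.+2)); last first.
  apply: ler_prod => i _; rewrite invr_ge0 exprn_ge0 ?(ltW mu0)//=.
  rewrite lef_pV2 ?posrE ?exprn_gt0//; apply: ler_weXn2l => //.
rewrite prodr_const card_ord exprVn -exprM expRN lef_pV2 ?posrE ?exprn_gt0 ?expR_gt0//.
apply: (@le_trans _ _ (expR (N ^- 2) ^+ (m.+2 * m.+2))).
  by apply: lerXn2r; rewrite ?nnegrE ?(ltW mu0) ?expR_ge0// emu; exact: expR_ge1Dx.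
rewrite -expRM_natl natrM -/N (_ : _ * _ = 1)// expr2 invfM.
by field; rewrite gt_eqF.
Qed.

Lemma decay_bound (delta : R) : 0 < delta -> exists2 K : R, 0 <= K & forall m (N mu t : R),
  N = m.+2%:R -> mu = 1 + N ^- 2 -> t = (mu - 1) ^+ 2 / (2 * mu) ->
  16 * expR (2 - delta ^+ 2 * N) * (\prod_(i < m) jac i) +
     4 * expR (- (delta * N)) * (\prod_(i < m.+1) jac i) <=
  K * m.+3%:R^-1 * ((\prod_(i < m.+2) mu ^- i.+1) * (t * \prod_(i < m.+1) jac i.+1)).
Proof.
move=> d0; have [F F0 HF] : exists2 F : R, 0 <= F & forall c N : R, 0 < c -> 0 < N ->
    expR (- (c * N)) <= F / (c ^+ 7 * N ^+ 7).
  by exists 7`!%:R => //; exact: (expR_decay 6).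
pose C1 : R := 16 * expR 2 * (F / (delta ^+ 2) ^+ 7) * 64.
pose C2 : R := 4 * (F / delta ^+ 7) * 16.
have d20 : 0 < delta ^+ 2 by rewrite exprn_gt0.
have C10 : 0 <= C1 by rewrite !mulr_ge0 ?expR_ge0// invr_ge0 exprn_ge0// ltW.
have C20 : 0 <= C2 by rewrite !mulr_ge0 ?expR_ge0// invr_ge0 exprn_ge0// ltW.
exists (8 * expR 1 * (C1 + C2)); first by rewrite !mulr_ge0 ?expR_ge0// addr_ge0.
move=> m N mu t eN emu et.
have N2 : 2 <= N by rewrite eN ler_nat.
have N0 : 0 < N by lra.
set W := \prod_(i < m.+2) _; set P1 := \prod_(i < m.+1) jac i.+1.
set Pm := \prod_(i < m) _; set Pm1 := \prod_(i < m.+1) jac i.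
have P10 : 0 <= P1 by apply: prodr_ge0 => i _; rewrite ltW// jac_gt0.
have Pm0 : 0 <= Pm by apply: prodr_ge0 => i _; rewrite ltW// jac_gt0.
have Pm10 : 0 <= Pm1 by apply: prodr_ge0 => i _; rewrite ltW// jac_gt0.
have inv_jac i (x y : R) : 0 <= x -> x * jac i = y -> x <= 4 * i.+1%:R * y.
  move=> x0 <-; have := @jac_ge R i.
  have q0 : 0 < 4 * i.+1%:R :> R by rewrite mulr_gt0.
  rewrite -(ler_pM2l q0) divff ?gt_eqF// => h.
  rewrite mulrCA -[leLHS]mulr1; exact: ler_wpM2l.
have eP : Pm1 * jac m.+1 = jac 0 * P1.
  by rewrite /Pm1 /P1 -(big_ord_recr m.+1 (fun i => @jac R i)) big_ord_recl.
have b1 : Pm1 <= 16 * N * P1.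
  apply: (le_trans (inv_jac _ _ _ Pm10 eP)); rewrite -eN.
  have := @jac_le4 R 0; have := @jac_gt0 R 0 => j0 j4.
  have : jac 0 * P1 <= 4 * P1 by apply: ler_wpM2r.
  by nra.
have b0 : Pm <= 64 * N ^+ 2 * P1.
  have eq : Pm * jac m = Pm1 by rewrite /Pm1 big_ord_recr.
  apply: (le_trans (inv_jac _ _ _ Pm0 eq)).
  apply: (@le_trans _ _ (4 * N * Pm1)).
    by rewrite ler_wpM2r// ler_wpM2l// eN ler_nat.
  rewrite (_ : 64 * N ^+ 2 * P1 = 4 * N * (16 * N * P1)); last by ring.
  by rewrite ler_wpM2l// mulr_ge0// ltW.
have E1 := HF (delta ^+ 2) N d20 N0.
have E2 := HF delta N d0 N0.
pose Q := P1 / N ^+ 5.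
have Q0 : 0 <= Q by rewrite divr_ge0// exprn_ge0// ltW.
have T1 : 16 * expR (2 - delta ^+ 2 * N) * Pm <= C1 * Q.
  rewrite expRD (_ : C1 * Q = 16 * (expR 2 * (F / ((delta ^+ 2) ^+ 7 * N ^+ 7))) * (64 * N ^+ 2 * P1)); last first.
    by rewrite /C1 /Q; field; rewrite !gt_eqF.
  apply: ler_pM => //.
  by rewrite ler_wpM2l// ler_wpM2l ?expR_ge0.
have T2 : 4 * expR (- (delta * N)) * Pm1 <= C2 * Q.
  apply: (@le_trans _ _ (4 * (F / (delta ^+ 7 * N ^+ 7)) * (16 * N * P1))).
    by apply: ler_pM => //; rewrite ler_wpM2l.
  rewrite (_ : 4 * _ * _ = C2 * (Q / N)); last by rewrite /C2 /Q; field; rewrite !gt_eqF.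
  rewrite ler_wpM2l// ler_pdivrMr// -[leLHS]mulr1 ler_wpM2l//; lra.
have W1 : expR (- 1) <= W by apply: prod_wscale_ge; rewrite emu eN.
have mu1 : 1 < mu by rewrite emu ltrDl invr_gt0 exprn_gt0.
have mu2 : mu <= 2.
  have : N ^- 2 <= 1 by rewrite invf_le1 ?exprn_gt0// exprn_ege1//; lra.
  by rewrite emu; lra.
have t1 : N ^- 4 / 4 <= t.
  rewrite et (_ : mu - 1 = N ^- 2); last by rewrite emu; ring.
  rewrite -exprVn -exprVn -exprM ler_wpM2l ?exprn_ge0 ?invr_ge0 ?(ltW N0)//.
  by rewrite lef_pV2 ?posrE//; lra.
have WtP : expR (- 1) * (N ^- 4 / 4 * P1) <= W * (t * P1).
  apply: ler_pM; rewrite ?expR_ge0 ?ler_wpM2r//.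
  by rewrite !mulr_ge0 ?invr_ge0 ?exprn_ge0 ?(ltW N0).
apply: (@le_trans _ _ ((C1 + C2) * Q)); first by rewrite [leRHS]mulrDl; exact: lerD T1 T2.
have N1 : m.+3%:R = N + 1 :> R by rewrite eN natr1.
apply: (@le_trans _ _ (8 * expR 1 * (C1 + C2) * m.+3%:R^-1 * (expR (- 1) * (N ^- 4 / 4 * P1)))); last first.
  by apply: ler_wpM2l => //; rewrite !mulr_ge0 ?expR_ge0 ?addr_ge0.
rewrite (_ : 8 * _ * _ * _ * _ = (C1 + C2) * (Q * (2 * N / (N + 1)))); last first.
  rewrite N1 expRN /Q; have e0 := expR_gt0 (1 : R); have N10 : 0 < N + 1 by lra.
  move: (expR 1) e0 => e e0; field.
  by rewrite !gt_eqF.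
rewrite ler_wpM2l ?addr_ge0// -[leLHS]mulr1 ler_wpM2l//.
by rewrite ler_pdivlMr; lra.
Qed.

Local Open Scope ereal_scope.

Lemma ratio_le (x y : \bar R) (r l : R) : (0 < l)%R -> (0 <= r)%R ->
  0 <= x -> x <= (r * l)%:E -> l%:E <= y -> x / y <= r%:E.
Proof.
move=> l0 r0 x0 xr; case: y => [s|_|//]; last by rewrite invey mule0 lee_fin.
rewrite lee_fin => ls; have s0 : (0 < s)%R by exact: lt_le_trans ls.
rewrite inver gt_eqF//; apply: (@le_trans _ _ ((r * l)%:E * (s^-1)%:E)).
  by apply: lee_wpmul2r => //; rewrite lee_fin invr_ge0 ltW.
rewrite -EFinM lee_fin ler_pdivrMr//; exact: ler_wpM2l.
Qed.

End Final.

Theorem theorem1p2 (R : realType) (f : R[i] -> R) (eps : R)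
    (f_bounded : exists M : R, forall z : R[i], `|f z| <= M)
    (f_continuous : continuous (f : (R[i])^o -> R)) (eps_gt0 : 0 < eps) :
  ((fun N : nat => normalized_lebesgue (Omega R N)
      [set a | eps < `|root_average f a - circle_average f|])
    @ \oo --> 0%E) /\
  ((fun N : nat => normalized_lebesgue (OmegaP R N)
      [set a | eps < `|root_average f a - circle_average f|])
    @ \oo --> 0%E).
Proof.
have [delta delta0 Hdelta] := root_average_close f_bounded f_continuous eps_gt0.
have [K K0 HK] := decay_bound delta0.
suff H (D : forall N, set (N.-tuple R)) :
    (forall N, OmegaP R N `<=` D N) -> (forall N, D N `<=` Omega R N) ->
    (fun N : nat => normalized_lebesgue (D N)
      [set a | eps < `|root_average f a - circle_average f|]) @ \oo --> 0%E.
  have OPO N : OmegaP R N `<=` Omega R N by move=> a [].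
  by split; apply: H => // N a.
move=> OD DO.
apply: (@squeeze_cvge _ _ _ _ (cst 0%E) _ (fun N => (K%:E * (harmonic N)%:E)%E)); last 2 first.
- exact: cvg_cst.
- rewrite -(mule0 K%:E); apply: cvgeZl => //; exact: cvge_harmonic.
exists 2%N => // -[|[|m]]//= _.
set A := [set a | _].
have l0 n (B : set (n.-tuple R)) : (0 <= lebesgue_tuple n B)%E by exact: measure_ge0.
rewrite /normalized_lebesgue mule_ge0 ?inve_ge0//=.
have N0 : 0 < m.+2%:R :> R by rewrite ltr0n.
pose mu : R := 1 + m.+2%:R ^- 2.
have mu1 : 1 < mu by rewrite ltrDl invr_gt0 exprn_gt0.
pose t := (mu - 1) ^+ 2 / (2 * mu).
have mup : 0 < 2 * mu by rewrite mulr_gt0// (lt_trans ltr01).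
have t0 : 0 < t by rewrite divr_gt0// exprn_gt0// subr_gt0.
have tmu : t * (2 * mu) <= (mu - 1) ^+ 2 by rewrite divfK// gt_eqF.
have lower := lebesgue_tuple_OmegaP_ge m mu1 t0 tmu.
set l := _ * _ in lower.
have lp : 0 < l.
  rewrite mulr_gt0//; first by apply: prodr_gt0 => i _; rewrite invr_gt0 exprn_gt0// (lt_trans ltr01).
  by rewrite mulr_gt0//; apply: prodr_gt0 => i _; exact: jac_gt0.
rewrite -EFinM; apply: (ratio_le lp).
- by rewrite mulr_ge0// harmonic_ge0.
- exact: l0.
- have HA (a : m.+2.-tuple R) : A a -> Omega R m.+2 a ->
    ~ [/\ forall i, (i < m.+2)%N -> `|nth 0 (refl m.+2 a) i| < 1,
          \sum_(k <- refl m.+2 a) `|k| <= delta * m.+2%:R &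
          expR (- (delta * m.+2%:R)) <= `|nth 0 a m.+1|].
    move=> Aa Oa [h1 h2 h3].
    by have := Hdelta _ a isT Oa h1 h2 h3; rewrite leNgt Aa.
  apply: le_trans (_ : (lebesgue_tuple m.+2 (A `&` Omega R m.+2) <= _)%E).
    by apply: lebesgue_tuple_mono; apply: setIS; exact: DO.
  apply: (le_trans (lebesgue_tuple_bad_le delta0 HA)).
  by rewrite lee_fin; exact: (HK m _ _ _ erefl erefl erefl).
- by apply: (le_trans lower); apply: lebesgue_tuple_mono; exact: OD.
Qed.
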